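(* Let $\{e_i\}_{i\ge1}$ be a sequence of pairwise distinct real numbers contained in a bounded interval, and let $\boldsymbol{S}=\prod_{i=1}^\infty S^2$. There exists a residual set $\mathcal{G}\subset\boldsymbol{S}$ such that for every $\boldsymbol{X}\in\mathcal{G}$ there exists a sequence $\{\mathbf{u}^N\}_{N\ge 1}$ of controls, namely the truncated feedback controls $$u_1^N=\sum_{i=1}^N2^{-i}y_{e_i},\qquad u_2^N=\sum_{i=1}^N2^{-i}x_{e_i},$$ such that the sequence $\{\boldsymbol{\Xi}^N\}_{N\ge1}$ of solutions of the equation $\dot{\boldsymbol{\Xi}}^N=\boldsymbol{F}(\boldsymbol{\Xi}^N,\mathbf{u}^N)$ with initial condition $\boldsymbol{\Xi}^N(0)=\boldsymbol{X}$ converges asymptotically pointwise to $\boldsymbol{X}^-$.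
   Context: Points of $\boldsymbol{S}$ are sequences $\boldsymbol{X}=\{X_{e_i}\}_{i\ge1}$ with $X_{e_i}=(x_{e_i},y_{e_i},z_{e_i})\in S^2\subset\mathbb{R}^3$. The point $\boldsymbol{X}^-\in\boldsymbol{S}$ has all components equal to $(0,0,-1)$. The space $\boldsymbol{S}$ is endowed with the distance $\boldsymbol{d}(\boldsymbol{X},\boldsymbol{X}')=\sum_{i=1}^\infty2^{-i}|X_{e_i}-X'_{e_i}|$ (Euclidean norm in $\mathbb{R}^3$) and the topology it induces. For $\mathbf{u}=(u_1,u_2)$, $\boldsymbol{F}(\boldsymbol{X},\mathbf{u})=\{F_{e_i}(\boldsymbol{X},\mathbf{u})\}_{i\ge1}$ with $$F_{e_i}(\boldsymbol{X},\mathbf{u})=\begin{pmatrix}0&-e_i&u_2\\ e_i&0&u_1\\ -u_2&-u_1&0\end{pmatrix}X_{e_i}.$$ In $\dot{\boldsymbol{\Xi}}^N=\boldsymbol{F}(\boldsymbol{\Xi}^N,\mathbf{u}^N)$ the feedback $\mathbf{u}^N=(u_1^N,u_2^N)$ is evaluated along $\boldsymbol{\Xi}^N$ itself; for initial conditions in $\boldsymbol{S}$ the solution exists and remains in $\boldsymbol{S}$ for all times. Residual set: a set containing a countable intersection of open dense subsets of $\boldsymbol{S}$. Asymptotic pointwise convergence: a sequence of functions $\boldsymbol{\Xi}^N(\cdot):\mathbb{R}\to\boldsymbol{S}$ converges asymptotically pointwise to $\boldsymbol{X}\in\boldsymbol{S}$ if for every $\epsilon>0$ there exists an integer $\bar N>0$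 such that for every $N\ge\bar N$ there exists a time $t(N,\epsilon)$ such that $\boldsymbol{d}(\boldsymbol{\Xi}^N(t),\boldsymbol{X})\le\epsilon$ for all $t\ge t(N,\epsilon)$. *)

(* Defs.v *)
From HB Require Import structures.
From mathcomp Require Import all_boot all_order all_algebra.
From mathcomp Require Import boolp classical_sets functions reals topology.
From mathcomp Require Import normedtype sequences derive.
From mathcomp Require Import ring lra.

Set Implicit Arguments.
Unset Strict Implicit.
Unset Printing Implicit Defensive.

Import Order.TTheory GRing.Theory Num.Theory.
Import numFieldNormedType.Exports.
Local Open Scope classical_set_scope.
Local Open Scope ring_scope.

(* Sequences are indexed from 0: index i stands for i + 1, so the weight of
   index i is 2 ^- i.+1, and \sum_(i < N) has the N terms 1, ..., N. *)

(* The library norm `|v| on column vectors is the sup norm. *)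
Definition enorm {R : rcfType} {n : nat} (v : 'cV[R]_n) : R :=
  Num.sqrt (\sum_(i < n) v i 0 ^+ 2).

Section enorm_theory.
Context {R : rcfType}.
Implicit Types v w : 'cV[R]_3.

Lemma enormE v :
  enorm v = Num.sqrt (v 0 0 ^+ 2 + v 1 0 ^+ 2 + v 2 0 ^+ 2).
Proof.
rewrite /enorm !big_ord_recl big_ord0 addr0 addrA.
by congr (Num.sqrt (v _ 0 ^+ 2 + v _ 0 ^+ 2 + v _ 0 ^+ 2)); apply: val_inj.
Qed.

Lemma enorm_ge0 v : 0 <= enorm v. Proof. exact: sqrtr_ge0. Qed.

Lemma sqr_enorm v : enorm v ^+ 2 = v 0 0 ^+ 2 + v 1 0 ^+ 2 + v 2 0 ^+ 2.
Proof. by rewrite enormE sqr_sqrtr// !addr_ge0 ?sqr_ge0. Qed.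

Lemma enormN v : enorm (- v) = enorm v.
Proof. by rewrite !enormE !mxE !sqrrN. Qed.

Lemma enorm0 : enorm (0 : 'cV[R]_3) = 0.
Proof. by rewrite enormE !mxE expr0n/= !addr0 sqrtr0. Qed.

Lemma enorm_eq0 v : enorm v = 0 -> v = 0.
Proof.
move=> v0; have /eqP : \sum_(i < 3) v i 0 ^+ 2 = 0.
  have S0 : 0 <= \sum_(i < 3) v i 0 ^+ 2 by apply: sumr_ge0 => i _; exact: sqr_ge0.
  by rewrite -(sqr_sqrtr S0) -/(enorm v) v0 expr0n.
rewrite psumr_eq0 => [/allP vi0|i _]; last exact: sqr_ge0.
apply/matrixP => i j; rewrite ord1 mxE; apply/eqP.
by have := vi0 i (mem_index_enum i); rewrite /= sqrf_eq0.
Qed.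

Lemma enormD v w : enorm (v + w) <= enorm v + enorm w.
Proof.
have a0 := enorm_ge0 v; have b0 := enorm_ge0 w.
have a2 := sqr_enorm v; have b2 := sqr_enorm w.
rewrite -ler_sqr ?nnegrE ?enorm_ge0 ?addr_ge0// sqr_enorm !mxE.
set p := v 0 0 in a2 *; set q := v 1 0 in a2 *; set r := v 2 0 in a2 *.
set x := w 0 0 in b2 *; set y := w 1 0 in b2 *; set z := w 2 0 in b2 *.
have CS : p * x + q * y + r * z <= enorm v * enorm w.
  apply: le_trans (ler_norm _) _.
  rewrite -ler_sqr ?nnegrE ?normr_ge0 ?mulr_ge0// real_normK ?num_real//.
  rewrite exprMn a2 b2 -subr_ge0.
  have -> : (p ^+ 2 + q ^+ 2 + r ^+ 2) * (x ^+ 2 + y ^+ 2 + z ^+ 2) -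
    (p * x + q * y + r * z) ^+ 2 =
    (p * y - q * x) ^+ 2 + (p * z - r * x) ^+ 2 + (q * z - r * y) ^+ 2 by ring.
  by rewrite !addr_ge0 ?sqr_ge0.
nra.
Qed.

End enorm_theory.

Record sphere2 (R : rcfType) := Sphere2 {
  sphere2_val :> 'cV[R]_3 ;
  _ : enorm sphere2_val == 1 }.
HB.instance Definition _ (R : rcfType) := [isSub for @sphere2_val R].
HB.instance Definition _ (R : rcfType) := [Choice of sphere2 R by <:].

Lemma enorm_sphere2 {R : rcfType} (p : sphere2 R) : enorm p = 1.
Proof. by case: p => v /= /eqP. Qed.

(* An alias of the function type: the only topology on it is the one induced
   by the metric declared below. *)
Definition state (R : realType) : Type := nat -> sphere2 R.
HB.instance Definition _ (R : realType) := gen_eqMixin (state R).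
HB.instance Definition _ (R : realType) := gen_choiceMixin (state R).

Definition state_dist {R : realType} (X Y : state R) : R :=
  limn (series (fun i => 2 ^- i.+1 * enorm (sphere2_val (X i) - sphere2_val (Y i)))).

Section state_dist_theory.
Context {R : realType}.
Implicit Types X Y Z : state R.

Let term X Y i : R := 2 ^- i.+1 * enorm (sphere2_val (X i) - sphere2_val (Y i)).

Let term_ge0 X Y i : 0 <= term X Y i.
Proof. by rewrite mulr_ge0 ?enorm_ge0 ?invr_ge0 ?exprn_ge0. Qed.

Lemma is_cvg_state_dist X Y :
  cvgn (series (fun i => 2 ^- i.+1 * enorm (sphere2_val (X i) - sphere2_val (Y i)))).
Proof.
apply: (@series_le_cvg _ (term X Y) (geometric 1 2^-1)) => [|i|i|].
- exact: term_ge0.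
- by rewrite /geometric/= mul1r exprn_ge0 ?invr_ge0.
- rewrite /geometric/= mul1r /term exprS invfM -exprVn mulrAC ler_piMl//.
    by rewrite exprn_ge0 ?invr_ge0.
  rewrite -ler_pdivlMl ?invr_gt0// invrK mulr1.
  apply: le_trans (enormD _ _) _.
  by rewrite enormN !enorm_sphere2 -natr1.
- by apply: is_cvg_geometric_series; rewrite ger0_norm ?invf_lt1 ?invr_ge0 ?ltr1n.
Qed.

Let state_distxx X : state_dist X X = 0.
Proof.
rewrite /state_dist (_ : series _ = cst 0); first exact: lim_cst.
apply/funext => n; rewrite /series/= big1// => i _.
by rewrite subrr enorm0 mulr0.
Qed.

Let state_dist_sym X Y : state_dist X Y = state_dist Y X.
Proof.
rewrite /state_dist; congr (limn (series _)); apply/funext => i.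
by rewrite -enormN opprB.
Qed.

Let state_dist_positivity X Y : state_dist X Y = 0 -> X = Y.
Proof.
move=> XY0; apply/funext => i; apply/val_inj/eqP.
rewrite -subr_eq0; apply/eqP/enorm_eq0.
have ndt : nondecreasing_seq (series (term X Y)).
  by apply/nondecreasing_series => n _ _; exact: term_ge0.
have t0 : term X Y i <= 0.
  rewrite -XY0; apply: le_trans (nondecreasing_cvgn_le ndt _ i.+1); last first.
    exact: is_cvg_state_dist.
  rewrite /series/= big_nat_recr//= lerDr sumr_ge0// => j _; exact: term_ge0.
apply/eqP; move: t0; rewrite /term pmulr_rle0 ?invr_gt0 ?exprn_gt0// => t0.
by rewrite eq_le t0 enorm_ge0.
Qed.

Let state_dist_triangle Y X Z :
  state_dist X Z <= state_dist X Y + state_dist Y Z.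
Proof.
rewrite /state_dist -lim_seriesD; [|exact: is_cvg_state_dist..].
apply: lim_series_le => [||i].
- exact: is_cvg_state_dist.
- by apply: is_cvg_seriesD; exact: is_cvg_state_dist.
- rewrite /= -mulrDr ler_wpM2l ?invr_ge0 ?exprn_ge0//.
  by rewrite -[X in enorm X](subrKA (sphere2_val (Y i))) enormD.
Qed.

HB.instance Definition _ := @isMetric.Build R (state R) state_dist
  state_distxx state_dist_positivity state_dist_sym state_dist_triangle.

End state_dist_theory.

Definition xcoord {R : rcfType} (p : sphere2 R) : R := (p : 'cV[R]_3) 0 0.
Definition ycoord {R : rcfType} (p : sphere2 R) : R := (p : 'cV[R]_3) 1 0.
Definition zcoord {R : rcfType} (p : sphere2 R) : R := (p : 'cV[R]_3) 2 0.

Definition south_vec (R : rcfType) : 'cV[R]_3 :=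
  \col_(i < 3) [:: 0; 0; -1]`_i.

Lemma enorm_south_vec (R : rcfType) : enorm (south_vec R) == 1.
Proof. by rewrite enormE !mxE/= expr0n/= !add0r sqrrN expr1n sqrtr1. Qed.

Definition south_pole (R : rcfType) : sphere2 R :=
  Sphere2 (enorm_south_vec R).

Definition Xminus (R : realType) : state R := fun=> south_pole R.

(* In a control u : R * R, u.1 is u_1 and u.2 is u_2. *)
Definition bloch_mx {R : realType} (a : R) (u : R * R) : 'M[R]_3 :=
  \matrix_(i < 3, j < 3)
    (nth [::] [:: [::    0;   -a; u.2];
                  [::    a;    0; u.1];
                  [:: -u.2; -u.1;   0]] i)`_j.

Definition field {R : realType} (e : nat -> R) (X : state R) (u : R * R) :
    nat -> 'cV[R]_3 :=
  fun i => bloch_mx (e i) u *m (X i : 'cV[R]_3).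

Definition truncated_feedback {R : realType} (N : nat) (X : state R) : R * R :=
  (\sum_(i < N) 2 ^- i.+1 * ycoord (X i), \sum_(i < N) 2 ^- i.+1 * xcoord (X i)).

(* The derivative is that of each component i, as a curve in the ambient R^3;
   Xi takes its values in state R, so the solution stays in the product. *)
Definition ivp_solution {R : realType} (e : nat -> R) (u : state R -> R * R)
    (X0 : state R) (Xi : R -> state R) : Prop :=
  Xi 0 = X0 /\
  forall (t : R) (i : nat),
    is_derive t (1 : R) (fun s : R => Xi s i : 'cV[R]_3)
      (field e (Xi t) (u (Xi t)) i).

Definition residual {T : topologicalType} (G : set T) : Prop :=
  exists U : nat -> set T,
    (forall n, open (U n) /\ dense (U n)) /\ \bigcap_n U n `<=` G.

Definition cvg_asymptotically_pointwise {R : realType}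
    (Xi : nat -> R -> state R) (X : state R) : Prop :=
  forall eps : R, 0 < eps -> exists2 Nbar : nat, (0 < Nbar)%N &
    forall N : nat, (Nbar <= N)%N -> exists T : R,
      forall t : R, T <= t -> mdist (Xi N t) X <= eps.

(* Main.v *)
Require Import Defs.
From mathcomp Require Import all_boot all_order all_algebra.
From mathcomp Require Import boolp classical_sets functions reals topology.
From mathcomp Require Import normedtype sequences derive realfun exp.
From mathcomp Require Import measure lebesgue_measure lebesgue_integral ftc.
From mathcomp Require Import ring lra.

Set Implicit Arguments.
Unset Strict Implicit.
Unset Printing Implicit Defensive.

Import Order.TTheory GRing.Theory Num.Theory.
Import numFieldNormedType.Exports.
Local Open Scope classical_set_scope.
Local Open Scope ring_scope.

(* Write w_j = x_j + i y_j, c_j for the weights and U = sum_{j<N} c_j w_j. Along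
   the closed loop V = sum_{j<N} c_j z_j has V' = -|U|^2. As the e_j are
   distinct, the Hermitian form
     B(w) = - sum_{j<>k} c_j c_k Im(conj(w_j) w_k) / (e_k - e_j)
   has derivative sum c_j^2 |w_j|^2 - |U|^2 along the free rotations, so that
   V - eps B is a strict Lyapunov function: w tends to 0, and every trajectory
   of the first N spins ends near a single configuration of poles z_j = s_j.
   Near such a configuration the same correction turns
   sum c_j s_j |X_j - X'_j|^2 / 2 into a quadratic form Q of the difference of
   two trajectories with Q' >= lambda Q. Hence Q <= 0 for two trajectories that
   stay there forever; moving only a spin with s_j = 1 makes Q positive, so the
   states that stay near a configuration with a north pole form a closed set
   with empty interior. A state outside these countably many sets has its first
   N spins sent to the south pole, for every N. *)

(** * Derivatives and primitives *)

(** The dissipation |U|^2 sees a single complex combination of the N spins, so the derivative of V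
    is far from coercive. The origin of B: |U|^2 is the sum of the squares c_j^2 |w_j|^2 and of
    cross terms c_j c_k Re(conj(w_j) w_k), which under the free rotations oscillate with frequency
    e_k - e_j; B is minus the primitive of these cross terms, so adding its derivative to |U|^2
    leaves the squares alone. The form Q plays the part of a stable manifold theorem: it compares
    two whole trajectories directly, without linearization. To move one spin only, the perturbation
    is made at a late time, inside the neighbourhood of the poles, and carried back to time 0. Hence
    existence, uniqueness and continuous dependence are all needed for negative times too. In the
    infinite product they are uniform because the e_j are bounded (existence) and because the first
    M spins evolve on their own once M >= N (dependence). *)

Section calculus.
Context {R : realType}.
Implicit Types (f g df : R -> R) (a b c t K : R).

Lemma derive_ub f df K a b : a <= b ->
  (forall t, a <= t <= b -> is_derive t (1 : R) f (df t)) ->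
  (forall t, a <= t <= b -> df t <= K) -> f b - f a <= K * (b - a).
Proof.
move=> ab fdf dfK.
have [||c cab ->] := @MVT_segment R f df a b ab.
- move=> t; rewrite in_itv/= => /andP[at_ tb].
  by apply: fdf; rewrite !ltW.
- apply: derivable_within_continuous => t; rewrite in_itv/= => tab.
  by have [] := fdf _ tab.
- by rewrite ler_wpM2r ?subr_ge0// dfK//; move: cab; rewrite in_itv.
Qed.

Lemma derive_abs_ub f df K s t :
  (forall u, is_derive u (1 : R) f (df u)) ->
  (forall u, `|u - s| <= `|t - s| -> `|df u| <= K) ->
  `|f t - f s| <= K * `|t - s|.
Proof.
move=> fdf dfK.
suff H a b : a <= b -> (forall u, a <= u <= b -> `|df u| <= K) ->
    `|f b - f a| <= K * (b - a).
  have [st|/ltW ts] := leP s t.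
    rewrite (@ger0_norm _ (t - s)) ?subr_ge0//; apply: H => // u /andP[su ut].
    by apply: dfK; rewrite !ger0_norm ?subr_ge0// lerB.
  rewrite distrC (@ler0_norm _ (t - s)) ?subr_le0// opprB; apply: H => // u /andP[su ut].
  by apply: dfK; rewrite !ler0_norm ?subr_le0// !opprB lerB.
move=> ab H; rewrite ler_norml; apply/andP; split; last first.
  apply: (@derive_ub _ df) => // u uab.
  exact: le_trans (ler_norm _) (H _ uab).
rewrite lerNl.
have : (- f) b - (- f) a <= K * (b - a).
  apply: (@derive_ub _ (fun u => - df u)) => // u uab.
  by apply: le_trans (H _ uab); rewrite -normrN ler_norm.
by rewrite /= !fctE; lra.
Qed.

Lemma derive_ge0_nondecreasing f df a b : a <= b ->
  (forall t, a <= t <= b -> is_derive t (1 : R) f (df t)) ->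
  (forall t, a <= t <= b -> 0 <= df t) -> f a <= f b.
Proof.
move=> ab fdf df0.
have : (- f) b - (- f) a <= 0 * (b - a).
  apply: (@derive_ub _ (fun t => - df t)) => // t tab.
    by have ? := fdf _ tab; exact: is_deriveN.
  by rewrite oppr_le0 df0.
by rewrite mul0r /= !fctE opprK addrC subr_le0.
Qed.

Lemma derivative_continuous f df :
  (forall t, is_derive t (1 : R) f (df t)) -> continuous f.
Proof.
move=> fdf t; have [d _] := fdf t.
exact/differentiable_continuous/derivable1_diffP.
Qed.

Lemma is_derive_shift f c t l :
  is_derive (t + c) (1 : R) f l -> is_derive t (1 : R) (fun s => f (s + c)) l.
Proof.
move=> fl; rewrite -[l]mulr1.
apply: (@is_derive1_comp R f (fun s => s + c) t).
have : is_derive t (1 : R) (id + cst c) (1 + 0) by exact: is_deriveD.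
by rewrite addr0.
Qed.

Lemma is_derive_reflect f t l :
  is_derive (- t) (1 : R) f l -> is_derive t (1 : R) (fun s => f (- s)) (- l).
Proof.
move=> fl; rewrite -mulrN1.
exact: (@is_derive1_comp R f -%R t).
Qed.

(** A quadratic error bound that is uniform along a sequence survives a pointwise limit. This is how
    the limit of the Picard iterates is differentiated. *)
Lemma is_derive_sq_error f t l K :
  (forall s, `|f s - f t - (s - t) * l| <= K * `|s - t| ^+ 2) ->
  is_derive t (1 : R) f l.
Proof.
move=> H.
have K0 : 0 <= K.
  have := le_trans (normr_ge0 _) (H (t + 1)).
  by rewrite (_ : t + 1 - t = 1) ?normr1 ?expr1n ?mulr1//; ring.
suff C : h^-1 *: (f (h *: (1 : R) + t) - f t) @[h --> 0^'] --> l.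
  by split; [apply/cvg_ex; exists l|exact/cvg_lim].
apply/cvgrPdist_le => eps eps0.
near=> h.
have h0 : h != 0 by near: h; exact: nbhs_dnbhs_neq.
have := H (h *: 1 + t); rewrite addrK [h *: 1]mulr1 => Hh.
rewrite (_ : l - _ = - h^-1 * (f (h + t) - f t - h * l)); last first.
  by rewrite -[h^-1 *: _]/(h^-1 * _); field.
rewrite normrM normrN normfV ler_pdivrMl ?normr_gt0//.
apply: le_trans Hh _.
rewrite expr2 mulrA mulrC ler_wpM2l//.
apply: (@le_trans _ _ ((K + 1) * `|h|)); first by rewrite ler_wpM2r// lerDl.
rewrite -ler_pdivlMl ?ltr_wpDl//.
by near: h; apply: dnbhs0_le; rewrite mulr_gt0 ?invr_gt0 ?ltr_wpDl.
Unshelve. all: by end_near. Qed.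

Let prim_from c f (t : R) : R := (\int[lebesgue_measure]_(s in `[c, t]) f s)%R.

Let prim_fromP c f t : continuous f -> c < t ->
  is_derive t (1 : R) (prim_from c f) (f t).
Proof.
move=> cf ct.
have [] := @continuous_FTC1_closed R f c t (t + 1) _ _ ct (cf t).
- by rewrite ltrDl.
- apply: continuous_compact_integrable; first exact: segment_compact.
  exact: continuous_subspaceT.
- by move=> d E; split; [exact: d|rewrite -derive1E; exact: E].
Qed.

Lemma continuous_primitive f : continuous f ->
  exists F, F 0 = 0 /\ forall t, is_derive t (1 : R) F (f t).
Proof.
(* The integral from -A is a primitive only to the right of -A. Normalizing it to vanish at 0 makes
   its value independent of A ([GE]), so a lower limit that moves with t gives one primitive on the
   whole line. *)
move=> cf; pose G A t := prim_from (- A) f t - prim_from (- A) f 0.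
have GE A B t : `|t| < A -> `|t| < B -> G A t = G B t.
  move=> tA tB; apply/eqP; rewrite -subr_eq0; apply/eqP.
  pose D := prim_from (- A) f - prim_from (- B) f.
  have dD s : `|s| <= `|t| -> is_derive s (1 : R) D 0.
    move=> st; rewrite -(subrr (f s)).
    have NA : - A < s by rewrite ltrNl (le_lt_trans _ (le_lt_trans st tA))// -normrN ler_norm.
    have NB : - B < s by rewrite ltrNl (le_lt_trans _ (le_lt_trans st tB))// -normrN ler_norm.
    have dA := prim_fromP cf NA; have dB := prim_fromP cf NB.
    exact: (@is_deriveB _ _ _ _ _ _ _ _ _ dA dB).
  rewrite (_ : G A t - G B t = D t - D 0); last by rewrite /G /D !fctE; ring.
  suff H a b : a <= b -> (forall s, a <= s <= b -> `|s| <= `|t|) -> D b - D a = 0.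
    have [t0|/ltW t0] := leP 0 t.
      apply: H => // s /andP[s0 st]; rewrite !ger0_norm//.
    rewrite -opprB H ?oppr0// => s /andP[s0 st]; rewrite !ler0_norm//.
    by rewrite lerN2.
  move=> ab sab; apply/eqP; rewrite eq_le; apply/andP; split.
    rewrite -(mul0r (b - a)); apply: (@derive_ub _ (fun=> 0)) => // s /sab; exact: dD.
  rewrite subr_ge0; apply: (@derive_ge0_nondecreasing _ (fun=> 0)) => // s /sab; exact: dD.
exists (fun t => G (`|t| + 1) t); split; first by rewrite /G subrr.
move=> t; apply: (@near_eq_is_derive _ _ _ (G (`|t| + 2))).
  near=> s; apply: GE; last by rewrite ltrDl.
  suff : `|t - s| < 1.
    have := ler_normD t (s - t); rewrite addrCA subrr addr0 distrC; lra.
  by near: s; apply: (@nbhsx_ballx _ R^o t 1).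
have tA : - (`|t| + 2) < t.
  rewrite ltrNl; apply: (@le_lt_trans _ _ `|t|); last by rewrite ltrDl.
  by rewrite -normrN ler_norm.
rewrite -[f t]subr0.
exact: (@is_deriveB _ _ _ _ _ _ _ _ _ (prim_fromP cf tA) (is_derive_cst _ _ _)).
Unshelve. all: by end_near. Qed.

End calculus.

(** * Picard iteration *)

Section exponential_growth.
Context {R : realType}.
Implicit Types (f df : R -> R) (c t M : R).

Lemma is_derive_expRM c t :
  is_derive t (1 : R) (fun s => expR (c * s)) (c * expR (c * t)).
Proof.
rewrite mulrC; apply: (@is_derive1_comp R expR ( *%R c)).
by have := @is_deriveZ _ _ _ id c t 1 1 _; rewrite [c *: 1]mulr1; apply.
Qed.

(** Integration gains a factor 1 / c in the norm weighted by exp(- c |t|). With c large against the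
    Lipschitz constant, the Picard map contracts on the whole time axis at once. *)
Lemma derive_expR_ub f df M c t : 0 < c -> f 0 = 0 ->
  (forall s, is_derive s (1 : R) f (df s)) ->
  (forall s, `|df s| <= M * expR (c * `|s|)) ->
  `|f t| <= M / c * expR (c * `|t|).
Proof.
move=> c0 f0 fdf dfM.
have M0 : 0 <= M.
  by have := le_trans (normr_ge0 _) (dfM 0); rewrite normr0 mulr0 expR0 mulr1.
suff H (g dg : R -> R) s : 0 <= s -> g 0 = 0 -> (forall s, is_derive s (1 : R) g (dg s)) ->
    (forall s, `|dg s| <= M * expR (c * `|s|)) -> g s <= M / c * expR (c * s).
  have N (g dg : R -> R) : (forall s, is_derive s (1 : R) g (dg s)) ->
      forall s, is_derive s (1 : R) (- g) (- dg s).
    by move=> D s; have ? := D s; exact: is_deriveN.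
  have [t0|/ltW t0] := leP 0 t.
    rewrite (ger0_norm t0) ler_norml (H f df)// andbT lerNl.
    apply: (H (- f) (fun s => - df s)) => //.
    - by rewrite fctE f0 oppr0.
    - by move=> s; rewrite normrN.
  have Nt : 0 <= - t by rewrite oppr_ge0.
  have D s : is_derive s (1 : R) (fun s => f (- s)) (- df (- s)).
    exact: is_derive_reflect.
  have DM s : `|- df (- s)| <= M * expR (c * `|s|) by rewrite normrN -(normrN s).
  have := H (fun s => f (- s)) _ (- t) Nt _ D DM.
  have := H (- (fun s => f (- s))) _ (- t) Nt _ (N _ _ D).
  rewrite !fctE !oppr0 f0 !oppr0 !opprK (ler0_norm t0) ler_norml => H1 /(_ erefl) ->.
  by rewrite lerNl andbT; apply: H1 => // s; rewrite normrN.
move=> s0 g0 gdg dgM.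
have : (M / c \*o (fun s => expR (c * s)) - g) 0 <=
       (M / c \*o (fun s => expR (c * s)) - g) s.
  apply: (@derive_ge0_nondecreasing _ _
    (fun s => M / c *: (c * expR (c * s)) - dg s)) => // u /andP[u0 us].
    have ? := gdg u; have ? := is_derive_expRM c u.
    by apply: is_deriveB; apply: is_deriveZ.
  rewrite subr_ge0 [_ *: _]mulrA divfK ?gt_eqF//.
  by rewrite (le_trans (ler_norm _))// (le_trans (dgM _))// ger0_norm.
rewrite /= !fctE /= mulr0 expR0 g0 => H; rewrite -subr_ge0; apply: le_trans H.
by rewrite subr0 mulr1 divr_ge0// ltW.
Qed.

Lemma lipschitz_continuous f M :
  (forall s t, `|f s - f t| <= M * `|s - t|) -> continuous f.
Proof.
move=> H t; apply/cvgrPdist_le => eps eps0.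
have M0 : 0 <= M.
  by have := le_trans (normr_ge0 _) (H 1 0); rewrite subr0 normr1 mulr1.
have r0 : 0 < (M + 1)^-1 * eps by rewrite mulr_gt0 ?invr_gt0 ?ltr_wpDl.
near=> s.
apply: le_trans (H _ _) _.
apply: (@le_trans _ _ ((M + 1) * `|t - s|)); first by rewrite ler_wpM2r// lerDl.
rewrite -ler_pdivlMl; first apply: ltW; last by rewrite ltr_wpDl.
by near: s; exact: (@nbhsx_ballx _ R^o t _ r0).
Unshelve. all: by end_near. Qed.

End exponential_growth.

Section picard.
Context {R : realType} {I : Type}.
Variables (f : I -> (I -> R) -> R) (B L : R) (x0 : I -> R).
Hypothesis L_gt0 : 0 < L.
Hypothesis f_bounded : forall i X, `|f i X| <= B.
(** This is the Lipschitz condition for the sup norm over an arbitrary index type; quantifying over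
    the bound [d] avoids forming a supremum. *)
Hypothesis f_lipschitz : forall i X Y (d : R),
  (forall j, `|X j - Y j| <= d) -> `|f i X - f i Y| <= L * d.

Let primitive (g : R -> R) : R -> R :=
  xget (fun=> 0) [set F | F 0 = 0 /\ forall t, is_derive t (1 : R) F (g t)].

Let primitiveP g : continuous g ->
  primitive g 0 = 0 /\ forall t, is_derive t (1 : R) (primitive g) (g t).
Proof.
by move=> /continuous_primitive H; exact: (xgetPex (fun=> 0) H).
Qed.

Let P := fix P (k : nat) (t : R) (i : I) {struct k} : R :=
  if k is k'.+1 then x0 i + primitive (fun s => f i (P k' s)) t else x0 i.

Let B_ge0 (i : I) : 0 <= B.
Proof. exact: le_trans (normr_ge0 _) (f_bounded i (fun=> 0)). Qed.

Let P_derive_step k : (forall t s i, `|P k t i - P k s i| <= B * `|t - s|) ->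
  forall i, P k.+1 0 i = x0 i /\
    forall t, is_derive t (1 : R) (P k.+1 ^~ i) (f i (P k t)).
Proof.
move=> lipP i.
have [p0 dp] : primitive (fun s => f i (P k s)) 0 = 0 /\
    forall t, is_derive t (1 : R) (primitive (fun s => f i (P k s))) (f i (P k t)).
  apply: primitiveP; apply: (@lipschitz_continuous _ _ (L * B)) => s t.
  by rewrite -mulrA; apply: f_lipschitz => j.
split; first by rewrite /= p0 addr0.
move=> t; rewrite -[f i _]add0r.
exact: (@is_deriveD _ _ _ _ _ _ _ _ _ (is_derive_cst _ _ _) (dp t)).
Qed.

Let P_lipschitz k t s i : `|P k t i - P k s i| <= B * `|t - s|.
Proof.
elim: k t s i => [|k IH] t s i; first by rewrite /= subrr normr0 mulr_ge0 ?(B_ge0 i).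
have [_ dP] := P_derive_step IH i.
exact: (derive_abs_ub dP).
Qed.

Let P_derive k t i : is_derive t (1 : R) (P k.+1 ^~ i) (f i (P k t)).
Proof. by have [_] := P_derive_step (P_lipschitz k) i. Qed.

Let P_init k i : P k 0 i = x0 i.
Proof. by case: k => // k; have [->] := P_derive_step (P_lipschitz k) i. Qed.

(** With exponent c = 2 L each Picard step halves the weighted distance. The first step is at most B
    |t| <= (B / c) exp(c |t|), whence [C]. *)
Let C : R := B / (L *+ 2).
Let c : R := L *+ 2.
Let c_gt0 : 0 < c. Proof. by rewrite pmulrn_rgt0. Qed.

Let P_succ k t i :
  `|P k.+1 t i - P k t i| <= C * 2^-1 ^+ k * expR (c * `|t|).
Proof.
elim: k t i => [|k IH] t i.
  have cB := P_lipschitz 1 t 0 i; rewrite P_init subr0 in cB.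
  rewrite expr0 mulr1; apply: le_trans cB _; rewrite /C -/c -mulrA ler_wpM2l ?(B_ge0 i)//.
  by rewrite ler_pdivlMl// (le_trans _ (expR_ge1Dx _))// lerDr.
rewrite [2^-1 ^+ _]exprS mulrCA -mulrA.
have -> : 2^-1 * (C * 2^-1 ^+ k * expR (c * `|t|)) =
    L * (C * 2^-1 ^+ k) / c * expR (c * `|t|).
  by rewrite /c; field; rewrite gt_eqF.
apply: (@derive_expR_ub R (P k.+2 ^~ i - P k.+1 ^~ i)
  (fun t => f i (P k.+1 t) - f i (P k t))) => //.
- by rewrite !fctE !P_init subrr.
- by move=> s; exact: (@is_deriveB _ _ _ _ _ _ _ _ _ (P_derive _ _ _) (P_derive _ _ _)).
- by move=> s; rewrite -(mulrA L); apply: f_lipschitz => j; exact: IH.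
Qed.

Let bound (k : nat) (t : R) : R := C * 2^-1 ^+ k * expR (c * `|t|).

Let P_dist k n t i : `|P (n + k)%N t i - P k t i| <= 2 * bound k t.
Proof.
suff H : `|P (n + k)%N t i - P k t i| <= 2 * bound k t * (1 - 2^-1 ^+ n).
  apply: le_trans H _; rewrite ler_piMr ?gerBl ?exprn_ge0 ?invr_ge0//.
  have C0 : 0 <= C := divr_ge0 (B_ge0 i) (ltW c_gt0).
  by rewrite mulr_ge0// mulr_ge0 ?expR_ge0// mulr_ge0// exprn_ge0// invr_ge0.
elim: n => [|n IH]; first by rewrite add0n subrr normr0 subrr mulr0.
have := P_succ (n + k) t i; rewrite -addSn exprD.
have := ler_distD (P (n + k)%N t i) (P (n.+1 + k)%N t i) (P k t i).
move: IH; rewrite /bound exprS.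
set p := 2^-1 ^+ n; set q := 2^-1 ^+ k; set E := expR _; lra.
Qed.

Let bound_cvg t : bound k t @[k --> \oo] --> 0.
Proof.
have -> : 0 = C * 0 * expR (c * `|t|) :> R by rewrite mulr0 mul0r.
apply: cvgM; last exact: cvg_cst.
apply: cvgM; first exact: cvg_cst.
by apply: cvg_expr; rewrite ger0_norm ?invr_ge0// invf_lt1// ltr1n.
Qed.

Let X (t : R) (i : I) : R := limn (fun k => P k t i).

Let X_cvg t i : P k t i @[k --> \oo] --> X t i.
Proof.
apply/cauchy_cvgP/cauchy_exP => eps eps0.
have /cvgrPdist_lt /(_ (eps / 2)) := bound_cvg t.
rewrite divr_gt0// => /(_ isT) [k _ /(_ k (leqnn _))]/=.
rewrite sub0r normrN => Hk; exists (P k t i).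
exists k => // n /= kn; rewrite -(subnK kn) /ball/= distrC.
apply: le_lt_trans (P_dist _ _ _ _) _.
by rewrite mulrC -ltr_pdivlMr// (le_lt_trans (ler_norm _)).
Qed.

Let X_dist k t i : `|X t i - P k t i| <= 2 * bound k t.
Proof.
have H : `|P n t i - P k t i| @[n --> \oo] --> `|X t i - P k t i|.
  by apply: cvg_norm; apply: cvgB; [exact: X_cvg|exact: cvg_cst].
rewrite -(cvg_lim _ H)//; apply: limr_le; first by apply/cvg_ex; eexists; exact: H.
exists k => // n /= kn; rewrite -(subnK kn); exact: P_dist.
Qed.

Theorem picard_existence : exists Y : R -> I -> R, Y 0 = x0 /\
  forall t i, is_derive t (1 : R) (Y ^~ i) (f i (Y t)).
Proof.
exists X; split.
  apply/funext => i; apply: cvg_lim => //.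
  by rewrite (_ : (fun k => _) = cst (x0 i)); [exact: cvg_cst|apply/funext => k; exact: P_init].
move=> t i; apply: (@is_derive_sq_error _ _ _ _ (L * B)) => s.
have Hk k : `|P k.+1 s i - P k.+1 t i - (s - t) * f i (P k t)| <= L * B * `|s - t| ^+ 2.
  pose g := P k.+1 ^~ i - (fun u => u * f i (P k t)).
  rewrite (_ : _ - _ = g s - g t); last by rewrite /g !fctE; ring.
  rewrite expr2 mulrA; apply: (@derive_abs_ub _ _ (fun u => f i (P k u) - f i (P k t))).
    move=> u; apply: (@is_deriveB _ _ _ _ _ _ _ _ _ (P_derive _ _ _)).
    have -> : (fun u => u * f i (P k t)) = f i (P k t) *: (id : R -> R).
      by apply/funext => v; rewrite mulrC.
    by have := @is_deriveZ _ _ _ id (f i (P k t)) u 1 1 _; rewrite [_ *: 1]mulr1; apply.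
  move=> u us; apply: (@le_trans _ _ (L * (B * `|u - t|))).
    by apply: f_lipschitz => j.
  by rewrite -mulrA !ler_wpM2l ?(B_ge0 i)// ltW.
have fc : f i (P k t) @[k --> \oo] --> f i (X t).
  apply/cvgrPdist_le => eps eps0.
  have e' : 0 < eps / (L * 2) by rewrite divr_gt0// mulr_gt0.
  have /cvgrPdist_lt /(_ _ e')[m _ Hm] := bound_cvg t.
  exists m => // k /= /Hm; rewrite /= sub0r normrN => /(le_lt_trans (ler_norm _)) /ltW bk.
  apply: (@le_trans _ _ (L * (2 * bound k t))); first exact: f_lipschitz.
  by rewrite mulrA mulrC -ler_pdivlMr// mulr_gt0.
have H : `|P k.+1 s i - P k.+1 t i - (s - t) * f i (P k t)| @[k --> \oo] -->
    `|X s i - X t i - (s - t) * f i (X t)|.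
  apply: cvg_norm; apply: cvgB; last by apply: cvgM => //; exact: cvg_cst.
  have S (u : R) : P k.+1 u i @[k --> \oo] --> X u i.
    by have := @X_cvg u i; rewrite -cvg_shiftS.
  by apply: cvgB; exact: S.
rewrite -(cvg_lim _ H)//; apply: limr_le; first by apply/cvg_ex; eexists; exact: H.
exact: nearW.
Qed.

End picard.

(** * The cross form *)

Section derivative_rules.
Context {R : realType}.
Implicit Types (f g : R -> R) (t : R).

Lemma is_derive_eqfun f g t (df dg : R) : f =1 g -> df = dg ->
  is_derive t (1 : R) f df -> is_derive t (1 : R) g dg.
Proof. by move=> /funext -> ->. Qed.

Lemma is_derive_mul f g t (df dg : R) :
  is_derive t (1 : R) f df -> is_derive t (1 : R) g dg ->
  is_derive t (1 : R) (fun s => f s * g s) (df * g t + f t * dg).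
Proof.
move=> Df Dg; apply: is_derive_eqfun (is_deriveM Df Dg) => //.
by rewrite addrC [X in X + _]mulrC.
Qed.

Lemma is_derive_scale (k : R) f t (df : R) :
  is_derive t (1 : R) f df -> is_derive t (1 : R) (fun s => k * f s) (k * df).
Proof. by move=> Df; exact: (@is_deriveZ _ _ _ f k t 1 df Df). Qed.

Lemma is_derive_add f g t (df dg : R) :
  is_derive t (1 : R) f df -> is_derive t (1 : R) g dg ->
  is_derive t (1 : R) (fun s => f s + g s) (df + dg).
Proof. exact: is_deriveD. Qed.

Lemma is_derive_sub f g t (df dg : R) :
  is_derive t (1 : R) f df -> is_derive t (1 : R) g dg ->
  is_derive t (1 : R) (fun s => f s - g s) (df - dg).
Proof. exact: is_deriveB. Qed.

Lemma is_derive_sum_ord n (F : 'I_n -> R -> R) (dF : 'I_n -> R) t :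
  (forall i, is_derive t (1 : R) (F i) (dF i)) ->
  is_derive t (1 : R) (fun s => \sum_(i < n) F i s) (\sum_(i < n) dF i).
Proof.
move=> DF; apply: is_derive_eqfun (@is_derive_sum _ _ _ _ _ _ _ _ DF) => // s.
by rewrite fct_sumE.
Qed.

End derivative_rules.

Section cross_form.
Context {R : realType} (e : nat -> R).
Implicit Types (x y p q : nat -> R) (N : nat).

Definition weight (i : nat) : R := 2 ^- i.+1.

Definition wsum N x : R := \sum_(i < N) weight i * x i.

Definition coupling (j k : nat) : R := weight j * weight k / (e k - e j).

(* The diagonal terms vanish since [e k - e j = 0] there and [0^-1 = 0]. *)
Definition cross_form N x y : R :=
  - \sum_(j < N) \sum_(k < N) coupling j k * (x j * y k - y j * x k).

(** The share of the velocity (p, q), the part that is not free rotation, in the derivative of the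
    double sum of [cross_form]. *)
Definition cross_rest N x y p q : R :=
  \sum_(j < N) \sum_(k < N)
    coupling j k * (p j * y k + x j * q k - (q j * x k + y j * p k)).

(** The factor 4 counts the products in each bracket of [cross_rest]; it covers the two products of
    [cross_form] as well. *)
Definition coupling_norm N : R :=
  4 * \sum_(j < N) \sum_(k < N) `|coupling j k|.

Definition sqnorm2 N x y : R := \sum_(i < N) (x i ^+ 2 + y i ^+ 2).

Lemma weight_gt0 i : 0 < weight i.
Proof. by rewrite invr_gt0 exprn_gt0. Qed.

Lemma weight_ge0 i : 0 <= weight i.
Proof. exact/ltW/weight_gt0. Qed.

Lemma weight_le i j : (i <= j)%N -> weight j <= weight i.
Proof.
by move=> ij; rewrite /weight lef_pV2 ?posrE ?exprn_gt0// ler_weXn2l// ler1n.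
Qed.

Lemma sum_weight N : \sum_(i < N) weight i = 1 - 2 ^- N.
Proof.
elim: N => [|N IH]; first by rewrite big_ord0 expr0 invr1 subrr.
rewrite big_ord_recr /= IH /weight exprS.
have : (2 : R) ^+ N != 0 by rewrite expf_neq0// pnatr_eq0.
by move=> H; field.
Qed.

Lemma sum_weight_le1 N : \sum_(i < N) weight i <= 1.
Proof. by rewrite sum_weight gerBl invr_ge0 exprn_ge0. Qed.

Lemma wsum_le N x M : (forall i, (i < N)%N -> `|x i| <= M) -> 0 <= M ->
  `|wsum N x| <= M.
Proof.
move=> xM M0; apply: le_trans (ler_norm_sum _ _ _) _.
apply: (@le_trans _ _ (\sum_(i < N) weight i * M)).
  by apply: ler_sum => i _; rewrite normrM (ger0_norm (weight_ge0 i)) ler_wpM2l ?weight_ge0 ?xM.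
by rewrite -mulr_suml ler_piMl ?sum_weight_le1.
Qed.

Lemma wsumB N x y : wsum N (fun i => x i - y i) = wsum N x - wsum N y.
Proof. by rewrite /wsum -sumrB; apply: eq_bigr => i _; rewrite mulrBr. Qed.

Lemma sqr_le_sqnorm2 N x y i : (i < N)%N ->
  x i ^+ 2 + y i ^+ 2 <= sqnorm2 N x y.
Proof.
move=> iN; rewrite /sqnorm2 (bigD1 (Ordinal iN))//= lerDl.
by apply: sumr_ge0 => j _; rewrite addr_ge0 ?sqr_ge0.
Qed.

Lemma sqnorm2_ge0 N x y : 0 <= sqnorm2 N x y.
Proof. by apply: sumr_ge0 => j _; rewrite addr_ge0 ?sqr_ge0. Qed.

Lemma norm_le_sqnorm2 N x y i : (i < N)%N ->
  `|x i| <= Num.sqrt (sqnorm2 N x y) /\ `|y i| <= Num.sqrt (sqnorm2 N x y).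
Proof.
move=> iN; have H := sqr_le_sqnorm2 x y iN.
split; rewrite -sqrtr_sqr ler_wsqrtr//.
  by apply: le_trans H; rewrite lerDl sqr_ge0.
by apply: le_trans H; rewrite lerDr sqr_ge0.
Qed.

Lemma weighted_sqnorm2_ge N x y :
  weight N ^+ 2 * sqnorm2 N x y <=
  \sum_(i < N) weight i ^+ 2 * (x i ^+ 2 + y i ^+ 2).
Proof.
rewrite mulr_sumr; apply: ler_sum => i _.
rewrite ler_wpM2r ?addr_ge0 ?sqr_ge0//.
by rewrite ler_sqr ?nnegrE ?weight_ge0// weight_le// ltnW.
Qed.

Lemma coupling_norm_ge0 N : 0 <= coupling_norm N.
Proof. by rewrite mulr_ge0// sumr_ge0// => j _; rewrite sumr_ge0. Qed.

Let coupling_sum_le N (F : nat -> nat -> R) M :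
  (forall j k, (j < N)%N -> (k < N)%N -> `|F j k| <= 4 * M) ->
  `|\sum_(j < N) \sum_(k < N) coupling j k * F j k| <= coupling_norm N * M.
Proof.
move=> FM; apply: le_trans (ler_norm_sum _ _ _) _.
rewrite /coupling_norm mulrAC mulr_sumr; apply: ler_sum => j _.
apply: le_trans (ler_norm_sum _ _ _) _.
rewrite mulr_sumr; apply: ler_sum => k _.
by rewrite normrM mulrC ler_wpM2r// FM.
Qed.

Lemma cross_form_le N x y S :
  (forall i, (i < N)%N -> `|x i| <= S /\ `|y i| <= S) ->
  `|cross_form N x y| <= coupling_norm N * S ^+ 2.
Proof.
move=> xyS; rewrite normrN.
apply: (coupling_sum_le (F := fun j k => x j * y k - y j * x k)) => j k jN kN.
have [xj yj] := xyS j jN; have [xk yk] := xyS k kN.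
apply: le_trans (ler_normB _ _) _; rewrite !normrM.
have := ler_pM (normr_ge0 _) (normr_ge0 _) xj yk.
have := ler_pM (normr_ge0 _) (normr_ge0 _) yj xk.
have := sqr_ge0 S; rewrite expr2; lra.
Qed.

Lemma cross_rest_le N x y p q S P :
  (forall i, (i < N)%N -> `|x i| <= S /\ `|y i| <= S) ->
  (forall i, (i < N)%N -> `|p i| <= P /\ `|q i| <= P) ->
  `|cross_rest N x y p q| <= coupling_norm N * (S * P).
Proof.
move=> xyS pqP.
apply: (coupling_sum_le
  (F := fun j k => p j * y k + x j * q k - (q j * x k + y j * p k))) => j k jN kN.
have [xj yj] := xyS j jN; have [xk yk] := xyS k kN.
have [pj qj] := pqP j jN; have [pk qk] := pqP k kN.
apply: le_trans (ler_normB _ _) _.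
apply: le_trans (lerD (ler_normD _ _) (ler_normD _ _)) _; rewrite !normrM.
have := ler_pM (normr_ge0 _) (normr_ge0 _) pj yk.
have := ler_pM (normr_ge0 _) (normr_ge0 _) xj qk.
have := ler_pM (normr_ge0 _) (normr_ge0 _) qj xk.
have := ler_pM (normr_ge0 _) (normr_ge0 _) yj pk.
lra.
Qed.

Hypothesis e_inj : injective e.

(** The factor e k - e j cancels the denominator of the coupling off the diagonal and kills the
    diagonal, so what remains is the square of the weighted sums minus its diagonal terms. *)
Lemma coupling_rotation N x y :
  \sum_(j < N) \sum_(k < N)
     coupling j k * ((e k - e j) * (x j * x k + y j * y k)) =
  wsum N x ^+ 2 + wsum N y ^+ 2 -
  \sum_(i < N) weight i ^+ 2 * (x i ^+ 2 + y i ^+ 2).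
Proof.
have sq u : wsum N u ^+ 2 = \sum_(j < N) \sum_(k < N) weight j * u j * (weight k * u k).
  by rewrite expr2 {1}/wsum mulr_suml; apply: eq_bigr => j _; rewrite mulr_sumr.
rewrite !sq -big_split -sumrB; apply: eq_bigr => j _ /=.
rewrite -big_split /= (bigD1 j)//= [in RHS](bigD1 j)//=.
rewrite subrr mul0r mulr0 add0r.
transitivity (\sum_(k < N | k != j) (weight j * x j * (weight k * x k) +
  weight j * y j * (weight k * y k))); last by ring.
apply: eq_bigr => k kj.
rewrite /coupling; field.
rewrite subr_eq0 (inj_eq e_inj); apply: contraNneq kj => /val_inj ->//.
Qed.

Lemma cross_form_derive N (x y : R -> nat -> R) p q t :
  (forall i, (i < N)%N ->
     is_derive t (1 : R) (x ^~ i) (- e i * y t i + p i)) ->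
  (forall i, (i < N)%N ->
     is_derive t (1 : R) (y ^~ i) (e i * x t i + q i)) ->
  is_derive t (1 : R) (fun s => cross_form N (x s) (y s))
    (\sum_(i < N) weight i ^+ 2 * (x t i ^+ 2 + y t i ^+ 2) -
     (wsum N (x t) ^+ 2 + wsum N (y t) ^+ 2) -
     cross_rest N (x t) (y t) p q).
Proof.
move=> dx dy; rewrite /cross_form.
pose D (j k : 'I_N) : R :=
  coupling j k * (((- e j * y t j + p j) * y t k + x t j * (e k * x t k + q k)) -
    ((e j * x t j + q j) * x t k + y t j * (- e k * y t k + p k))).
have E : - (\sum_(j < N) \sum_(k < N) D j k) =
    \sum_(i < N) weight i ^+ 2 * (x t i ^+ 2 + y t i ^+ 2) -
     (wsum N (x t) ^+ 2 + wsum N (y t) ^+ 2) - cross_rest N (x t) (y t) p q.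
  rewrite -[in RHS](opprB (_ + _)) -coupling_rotation -opprD; congr (- _).
  rewrite /cross_rest -big_split; apply: eq_bigr => j _ /=.
  rewrite -big_split; apply: eq_bigr => k _ /=.
  by rewrite /D; ring.
rewrite -E; apply: is_deriveN.
apply: is_derive_sum_ord => j; apply: is_derive_sum_ord => k.
apply: is_derive_scale; apply: is_derive_sub; apply: is_derive_mul.
- exact: dx.
- exact: dy.
- exact: dy.
- exact: dx.
Qed.

End cross_form.

(** * Convergence to the poles *)

Section bloch_curves.
Context {R : realType} (e : nat -> R) (e_inj : injective e) (N : nat).

Definition bloch_curve (x y z : R -> nat -> R) : Prop := forall t i,
  [/\ is_derive t (1 : R) (x ^~ i) (- e i * y t i + wsum N (x t) * z t i),
      is_derive t (1 : R) (y ^~ i) (e i * x t i + wsum N (y t) * z t i),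
      is_derive t (1 : R) (z ^~ i) (- wsum N (x t) * x t i - wsum N (y t) * y t i) &
      x t i ^+ 2 + y t i ^+ 2 + z t i ^+ 2 = 1].

Lemma bloch_curve_le1 x y z t i : bloch_curve x y z ->
  [/\ `|x t i| <= 1, `|y t i| <= 1 & `|z t i| <= 1].
Proof.
move=> H; have [_ _ _ E] := H t i.
have := sqr_ge0 (x t i); have := sqr_ge0 (y t i); have := sqr_ge0 (z t i).
by move=> ? ? ?; split; rewrite -ler_sqr ?nnegrE// expr1n real_normK ?num_real//; lra.
Qed.

Lemma bloch_curve_sqnorm2_derive x y z t : bloch_curve x y z ->
  is_derive t (1 : R) (fun s => sqnorm2 N (x s) (y s))
    (\sum_(i < N) 2 * z t i * (wsum N (x t) * x t i + wsum N (y t) * y t i)).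
Proof.
move=> H; apply: is_derive_sum_ord => i.
have [dx dy _ _] := H t i.
apply: is_derive_eqfun (is_derive_add (is_derive_mul dx dx) (is_derive_mul dy dy)).
  by move=> s; rewrite !expr2.
ring.
Qed.

Let m : R := weight N ^+ 2.
Let C : R := coupling_norm e N.

Let m_gt0 : 0 < m. Proof. by rewrite exprn_gt0// weight_gt0. Qed.
Let C_ge0 : 0 <= C. Proof. exact: coupling_norm_ge0. Qed.

Lemma strict_lyapunov : exists2 delta : R, 0 < delta &
  exists K : R, forall x y z, bloch_curve x y z ->
    exists L dL : R -> R, forall t,
      [/\ is_derive t (1 : R) L (dL t),
          dL t <= - delta * sqnorm2 N (x t) (y t) & - K <= L t].
Proof.
(* Young's inequality bounds the rest by m / 2 |w|^2 + C^2 / m |U|^2, so the correction costs eps (1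
   + C^2 / m) |U|^2. This choice makes the cost exactly the |U|^2 that V provides, and -eps m / 2
   |w|^2 is left. *)
pose eps := (1 + C ^+ 2 / m)^-1.
have den : 0 < 1 + C ^+ 2 / m by rewrite ltr_pwDl// divr_ge0 ?sqr_ge0// ltW.
have eps0 : 0 < eps by rewrite invr_gt0.
exists (eps * m / 2); first by rewrite divr_gt0// mulr_gt0.
exists (1 + eps * C) => x y z H.
exists (fun t => wsum N (z t) - eps * cross_form e N (x t) (y t)).
set A := fun t => wsum N (x t) ^+ 2 + wsum N (y t) ^+ 2.
pose p t i := wsum N (x t) * z t i; pose q t i := wsum N (y t) * z t i.
exists (fun t => - A t - eps *
  (\sum_(i < N) weight i ^+ 2 * (x t i ^+ 2 + y t i ^+ 2) - A t -
   cross_rest e N (x t) (y t) (p t) (q t))) => t.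
split.
- apply: is_derive_sub; last first.
    apply: is_derive_scale.
    by apply: (cross_form_derive e_inj) => i _; have [] := H t i.
  apply: (@is_derive_eqfun _ (fun s => \sum_(i < N) weight i * z s i) _ _
    (\sum_(i < N) weight i * (- wsum N (x t) * x t i - wsum N (y t) * y t i))) => //.
    have lin (a b : R) : \sum_(i < N) weight i * (- a * x t i - b * y t i) =
        - a * wsum N (x t) - b * wsum N (y t).
      by rewrite /wsum !mulr_sumr -sumrB; apply: eq_bigr => i _; ring.
    by rewrite lin /A; ring.
  by apply: is_derive_sum_ord => i; apply: is_derive_scale; have [] := H t i.
- set n2 := sqnorm2 _ _ _.
  set S := Num.sqrt n2.
  have S2 : S ^+ 2 = n2 by rewrite sqr_sqrtr ?sqnorm2_ge0.
  set a := wsum N (x t); set b := wsum N (y t).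
  pose P := `|a| + `|b|.
  have P2 : P ^+ 2 <= 2 * A t.
    rewrite /P /A -/a -/b -(real_normK (num_real a)) -(real_normK (num_real b)).
    have := sqr_ge0 (`|a| - `|b|); lra.
  have rest : `|cross_rest e N (x t) (y t) (p t) (q t)| <= C * (S * P).
    apply: cross_rest_le => i iN; first exact: norm_le_sqnorm2.
    have [_ _ z1] := bloch_curve_le1 t i H.
    rewrite /p /q -/a -/b !normrM /P.
    have := ler_piMr (normr_ge0 a) z1; have := ler_piMr (normr_ge0 b) z1.
    by have := normr_ge0 a; have := normr_ge0 b => ? ? ? ?; split; lra.
  have W := weighted_sqnorm2_ge N (x t) (y t); rewrite -/m -/n2 -S2 in W.
  move: rest; rewrite ler_norml => /andP[_ rest].
  have young : C * (S * P) <= m / 2 * S ^+ 2 + C ^+ 2 / m * A t.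
    apply: (@le_trans _ _ (m / 2 * S ^+ 2 + C ^+ 2 / m * (P ^+ 2 / 2))); last first.
      rewrite lerD2l ler_wpM2l//; first by rewrite divr_ge0 ?sqr_ge0 ?ltW.
      by rewrite ler_pdivrMr// mulrC.
    rewrite -subr_ge0 (_ : _ - _ = (m * S - C * P) ^+ 2 / (2 * m)); last first.
      by field; rewrite gt_eqF.
    by rewrite divr_ge0 ?sqr_ge0// mulr_ge0// ltW.
  have epsE : eps * (1 + C ^+ 2 / m) = 1 by rewrite mulVf// gt_eqF.
  rewrite -S2.
  set W0 := \sum_(i < N) _ in W *; set rst := cross_rest _ _ _ _ _ _ in rest *.
  have : eps * (W0 - A t - rst) >= eps * (m / 2 * S ^+ 2 - (1 + C ^+ 2 / m) * A t).
    by rewrite ler_pM2l//; lra.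
  rewrite mulrBr mulrA (mulrA eps (1 + _)) epsE mul1r.
  lra.
- have V1 : `|wsum N (z t)| <= 1.
    by apply: wsum_le => // i _; have [] := bloch_curve_le1 t i H.
  have : `|cross_form e N (x t) (y t)| <= C * 1 ^+ 2.
    by apply: cross_form_le => i _; have [] := bloch_curve_le1 t i H.
  rewrite expr1n mulr1 => B1.
  have : eps * cross_form e N (x t) (y t) <= eps * C.
    by rewrite ler_pM2l// (le_trans (ler_norm _)).
  move: V1; rewrite ler_norml => /andP[]; lra.
Qed.

Lemma bloch_curve_equatorial_cvg x y z eta : bloch_curve x y z -> 0 < eta ->
  exists T, forall t, T <= t -> sqnorm2 N (x t) (y t) <= eta.
Proof.
move=> H eta0; have [delta delta0 [K /(_ _ _ _ H)[L [dL HL]]]] := strict_lyapunov.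
pose n2 t := sqnorm2 N (x t) (y t).
have Lni s t : s <= t -> L t <= L s.
  move=> st; rewrite -subr_le0 -(mul0r (t - s)).
  apply: (derive_ub (df := dL) st) => u _; first by have [] := HL u.
  have [_ /le_trans + _] := HL u; apply.
  by rewrite mulNr oppr_le0 mulr_ge0 ?sqnorm2_ge0 ?ltW.
pose D : R := 4 * N%:R + 1.
have D0 : 0 < D by rewrite ltr_wpDl// mulr_ge0.
(* n2 is D-Lipschitz, so n2 > eta at t forces n2 >= eta / 2 on [t, t + tau]. *)
have n2lip s t : `|n2 s - n2 t| <= D * `|s - t|.
  apply: (derive_abs_ub (fun u => bloch_curve_sqnorm2_derive u H)) => u _.
  apply: le_trans (ler_norm_sum _ _ _) _.
  apply: (@le_trans _ _ (\sum_(i < N) 4)); last first.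
    by rewrite sumr_const card_ord /D -[4 *+ N]mulr_natr lerDl.
  apply: ler_sum => i _; have [x1 y1 z1] := bloch_curve_le1 u i H.
  have a1 : `|wsum N (x u)| <= 1.
    by apply: wsum_le => // j _; have [] := bloch_curve_le1 u j H.
  have b1 : `|wsum N (y u)| <= 1.
    by apply: wsum_le => // j _; have [] := bloch_curve_le1 u j H.
  have : `|wsum N (x u) * x u i + wsum N (y u) * y u i| <= 2.
    apply: le_trans (ler_normD _ _) _; rewrite !normrM.
    have := ler_pM (normr_ge0 _) (normr_ge0 _) a1 x1.
    have := ler_pM (normr_ge0 _) (normr_ge0 _) b1 y1.
    rewrite mulr1; lra.
  move=> s2; rewrite -mulrA normrM (@ger0_norm _ 2)// normrM.
  have := ler_pM (normr_ge0 _) (normr_ge0 _) z1 s2.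
  rewrite mul1r; lra.
pose tau := eta / (2 * D).
have tau0 : 0 < tau by rewrite divr_gt0// mulr_gt0.
pose drop := delta * (eta / 2) * tau.
have drop0 : 0 < drop by rewrite mulr_gt0// mulr_gt0// divr_gt0.
have step t : eta < n2 t -> L (t + tau) <= L t - drop.
  move=> nt; have tt : t <= t + tau by rewrite lerDl ltW.
  have : L (t + tau) - L t <= - (delta * (eta / 2)) * (t + tau - t).
    apply: (derive_ub (df := dL) tt) => u /andP[tu ut]; first by have [] := HL u.
    have [_ /le_trans + _] := HL u; apply.
    rewrite mulNr lerN2 ler_pM2l//.
    have := n2lip u t; rewrite ler_norml => /andP[+ _].
    have ub : D * `|u - t| <= eta / 2.
      rewrite ger0_norm ?subr_ge0//.
      apply: (@le_trans _ _ (D * tau)); first by rewrite ler_pM2l//; lra.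
      by rewrite /tau (_ : D * _ = eta / 2)//; field; rewrite gt_eqF.
    by rewrite -/(n2 u); lra.
  by rewrite (_ : t + tau - t = tau) /drop; [lra|ring].
have Lge t : - K <= L t by have [] := HL t.
(* [L] decreases and is bounded below. Once it is within [drop] of its infimum it cannot lose [drop]
   any more, as it would at any later time with [n2] above [eta]. *)
pose rng := [set L t | t in [set: R]].
have hi : has_inf rng.
  split; first by exists (L 0), 0.
  by exists (- K) => _ [t _ <-].
have [_ [T _ <-] LT] := inf_adherent drop0 hi.
exists T => t Tt; rewrite leNgt; apply/negP => /step.
have : inf rng <= L (t + tau) by apply: ge_inf; [exact: hi.2|exists (t + tau)].
have := Lni _ _ Tt; lra.
Qed.

End bloch_curves.

(** * Differences of two closed-loop trajectories *)

Section pair_of_curves.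
Context {R : realType} (e : nat -> R) (N : nat).
Variables (x y z x' y' z' : R -> nat -> R).
Hypothesis H : bloch_curve e N x y z.
Hypothesis H' : bloch_curve e N x' y' z'.

Let dx t i := x t i - x' t i.
Let dy t i := y t i - y' t i.
Let dz t i := z t i - z' t i.
Let mx t i := (x t i + x' t i) / 2.
Let my t i := (y t i + y' t i) / 2.
Let mz t i := (z t i + z' t i) / 2.
Let da t := wsum N (dx t).
Let db t := wsum N (dy t).
Let ma t := (wsum N (x t) + wsum N (x' t)) / 2.
Let mb t := (wsum N (y t) + wsum N (y' t)) / 2.

(** Products are split symmetrically, a z - a' z' = da mz + ma dz with the means of both curves. In
    the derivative of the squared distance the terms in [ma] and [mb] then cancel. *)
Lemma x_diff_derive t i :
  is_derive t (1 : R) (dx ^~ i) (- e i * dy t i + (da t * mz t i + ma t * dz t i)).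
Proof.
have [D _ _ _] := H t i; have [D' _ _ _] := H' t i.
apply: is_derive_eqfun (is_derive_sub D D') => //.
by rewrite /da /ma /mz /dz /dx wsumB /dy; field.
Qed.

Lemma y_diff_derive t i :
  is_derive t (1 : R) (dy ^~ i) (e i * dx t i + (db t * mz t i + mb t * dz t i)).
Proof.
have [_ D _ _] := H t i; have [_ D' _ _] := H' t i.
apply: is_derive_eqfun (is_derive_sub D D') => //.
by rewrite /db /mb /mz /dz /dy wsumB /dx; field.
Qed.

Let z_diff_derive t i : is_derive t (1 : R) (dz ^~ i)
  (- (da t * mx t i + ma t * dx t i) - (db t * my t i + mb t * dy t i)).
Proof.
have [_ _ D _] := H t i; have [_ _ D' _] := H' t i.
apply: is_derive_eqfun (is_derive_sub D D') => //.
by rewrite /da /db /ma /mb /mx /my /dx /dy !wsumB; field.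
Qed.

(* Rotations preserve the distance of two spins, so only the difference
   [(da, db)] of the two controls contributes. *)
Lemma spin_sqdist_derive t i : is_derive t (1 : R)
  (fun u => dx u i ^+ 2 + dy u i ^+ 2 + dz u i ^+ 2)
  (2 * (mz t i * (da t * dx t i + db t * dy t i) -
        dz t i * (da t * mx t i + db t * my t i))).
Proof.
have D := is_derive_add (is_derive_add
  (is_derive_mul (x_diff_derive t i) (x_diff_derive t i))
  (is_derive_mul (y_diff_derive t i) (y_diff_derive t i)))
  (is_derive_mul (z_diff_derive t i) (z_diff_derive t i)).
apply: is_derive_eqfun D => [u|]; first by rewrite !expr2.
ring.
Qed.

End pair_of_curves.

(** * Separation of trajectories near the poles *)

Section cone.
Context {R : realType} (e : nat -> R) (e_inj : injective e) (N : nat).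

Definition polar_window (s : nat -> R) (r : R) (x y z : nat -> R) : Prop :=
  forall i, (i < N)%N -> x i ^+ 2 + y i ^+ 2 <= r ^+ 2 /\ 2^-1 <= s i * z i.

Section window_bounds.
Variables (r s x y z x' y' z' : R).
Hypotheses (r_ge0 : 0 <= r) (r_le : r <= 4^-1) (s1 : s ^+ 2 = 1).
Hypotheses (X1 : x ^+ 2 + y ^+ 2 + z ^+ 2 = 1) (X'1 : x' ^+ 2 + y' ^+ 2 + z' ^+ 2 = 1).
Hypotheses (Xr : x ^+ 2 + y ^+ 2 <= r ^+ 2) (X'r : x' ^+ 2 + y' ^+ 2 <= r ^+ 2).
Hypotheses (Xz : 2^-1 <= s * z) (X'z : 2^-1 <= s * z').

Let norm_le_r (u v : R) : u ^+ 2 + v ^+ 2 <= r ^+ 2 -> `|u| <= r /\ `|v| <= r.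
Proof.
move=> H; have := sqr_ge0 u; have := sqr_ge0 v => u0 v0.
by split; rewrite -ler_sqr ?nnegrE// real_normK ?num_real//; lra.
Qed.

Lemma window_mean_le : `|(x + x') / 2| <= r /\ `|(y + y') / 2| <= r.
Proof.
have [] := norm_le_r Xr; have [] := norm_le_r X'r.
rewrite !ler_norml => /andP[? ?] /andP[? ?] /andP[? ?] /andP[? ?].
by split; apply/andP; split; lra.
Qed.

(** Once s w lies in [0, 1], it dominates its own square: s w >= (s w)^2 = 1 - (u^2 + v^2) >= 1 -
    r^2 >= 1 - r. *)
Let window_z (u v w : R) : u ^+ 2 + v ^+ 2 + w ^+ 2 = 1 ->
  u ^+ 2 + v ^+ 2 <= r ^+ 2 -> 2^-1 <= s * w -> 1 - r <= s * w <= 1.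
Proof.
move=> E ur w2; have sw : (s * w) ^+ 2 = 1 - (u ^+ 2 + v ^+ 2).
  by rewrite exprMn s1 mul1r -E; ring.
have := sqr_ge0 u; have := sqr_ge0 v => u0 v0.
have sw0 : 0 <= s * w by lra.
have sw1 : s * w <= 1 by rewrite -ler_sqr ?nnegrE// sw expr1n; lra.
have r1 : r <= 1 by move: r_le; lra.
have rr : r ^+ 2 <= r by rewrite expr2 ler_piMl.
have : (s * w) ^+ 2 <= s * w by rewrite expr2 ler_piMl.
by rewrite sw1 andbT sw; lra.
Qed.

Lemma window_mean_z : `|s * ((z + z') / 2) - 1| <= r /\ `|(z + z') / 2| <= 1.
Proof.
have /andP[? ?] := window_z X1 Xr Xz; have /andP[? ?] := window_z X'1 X'r X'z.
split; first by rewrite ler_norml; apply/andP; split; move: r_ge0; lra.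
have sn : `|s| = 1 by apply/eqP; rewrite -sqrp_eq1// real_normK ?num_real// s1.
rewrite (_ : `|_| = `|s * ((z + z') / 2)|); last by rewrite [RHS]normrM sn mul1r.
by rewrite ler_norml; apply/andP; split; move: r_le; lra.
Qed.

(** Near a pole z is a flat function of (x, y). Subtracting the two sphere equations gives (z -
    z')(z + z') as a combination of x - x' and y - y' with coefficients of size 2 r, and |z + z'| >=
    1 since both points lie on the same side. *)
Lemma window_dz_le S : `|x - x'| <= S -> `|y - y'| <= S -> `|z - z'| <= 4 * r * S.
Proof.
move=> dx dy.
have sn : `|s| = 1 by apply/eqP; rewrite -sqrp_eq1// real_normK ?num_real// s1.
have z1 : 1 <= `|z + z'|.
  rewrite (_ : `|_| = `|s * (z + z')|); last by rewrite [RHS]normrM sn mul1r.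
  rewrite (le_trans _ (ler_norm _))//; move: Xz X'z; lra.
have [mx my] := window_mean_le.
have E : (z - z') * (z + z') =
    - ((x - x') * (2 * ((x + x') / 2)) + (y - y') * (2 * ((y + y') / 2))).
  by move: X1 X'1; lra.
move: mx my E; set u := (x + x') / 2; set v := (y + y') / 2 => mx my E.
clearbody u v.
apply: (@le_trans _ _ (`|(z - z') * (z + z')|)).
  by rewrite normrM ler_peMr.
rewrite E normrN; apply: le_trans (ler_normD _ _) _; rewrite !normrM (@ger0_norm _ 2)//.
have := ler_pM (normr_ge0 _) (normr_ge0 _) dx mx.
have := ler_pM (normr_ge0 _) (normr_ge0 _) dy my.
lra.
Qed.

End window_bounds.

Let m : R := weight N ^+ 2.
Let C : R := coupling_norm e N.
(** By [epsE] the correction uses up half of A = da^2 + db^2, and the other half pays for the error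
    of [denergy]. The radius satisfies 32 rad <= eps m and C rad <= eps m / 32, which lets eps m S^2
    absorb the errors that carry a factor [rad]. *)
Let eps : R := (2 * (1 + 2 * (C ^+ 2 / m)))^-1.
Let rad : R := eps * m / (32 * (1 + C)).

Let m_gt0 : 0 < m. Proof. by rewrite exprn_gt0// weight_gt0. Qed.
Let m_le1 : m <= 1.
Proof.
rewrite /m expr_le1 ?weight_ge0// /weight invf_le1 ?exprn_gt0//.
by rewrite exprn_ege1// ler1n.
Qed.
Let C_ge0 : 0 <= C. Proof. exact: coupling_norm_ge0. Qed.
Let C2m : 0 <= C ^+ 2 / m. Proof. by rewrite divr_ge0 ?sqr_ge0 ?ltW. Qed.
Let eps_gt0 : 0 < eps. Proof. by rewrite invr_gt0; move: C2m; move: (C ^+ 2 / m) => k; lra. Qed.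
Let epsE : eps * (1 + 2 * (C ^+ 2 / m)) = 2^-1.
Proof.
rewrite /eps invfM -mulrA mulVf ?mulr1// gt_eqF//.
by move: C2m; move: (C ^+ 2 / m) => k; lra.
Qed.
Let eps_le : eps <= 2^-1.
Proof.
have k1 : 1 <= 1 + 2 * (C ^+ 2 / m) by move: C2m; lra.
by rewrite -epsE ler_peMr ?(ltW eps_gt0).
Qed.
Let C1 : 0 < 1 + C. Proof. by move: C_ge0; lra. Qed.
Let rad_gt0 : 0 < rad.
Proof. by rewrite divr_gt0// mulr_gt0. Qed.
Let radE : rad * (32 * (1 + C)) = eps * m.
Proof. by rewrite /rad divfK// gt_eqF// mulr_gt0. Qed.
Let rad_le : 32 * rad <= eps * m.
Proof. by have := mulr_ge0 (ltW rad_gt0) C_ge0; move: radE; lra. Qed.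
Let Crad_le : C * rad <= eps * m / 32.
Proof. move: radE rad_gt0; lra. Qed.
Let epsm_le : eps * m <= 2^-1.
Proof. by rewrite (le_trans _ eps_le)// ler_piMr// ltW. Qed.
Let rad_le4 : rad <= 4^-1.
Proof. move: rad_le epsm_le; lra. Qed.

Section pair.
Variables (s : nat -> R) (x y z x' y' z' : R -> nat -> R).
Hypothesis s1 : forall i, s i ^+ 2 = 1.
Hypothesis H : bloch_curve e N x y z.
Hypothesis H' : bloch_curve e N x' y' z'.

Let dx t i := x t i - x' t i.
Let dy t i := y t i - y' t i.
Let dz t i := z t i - z' t i.
Let mx t i := (x t i + x' t i) / 2.
Let my t i := (y t i + y' t i) / 2.
Let mz t i := (z t i + z' t i) / 2.
Let da t := wsum N (dx t).
Let db t := wsum N (dy t).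
Let ma t := (wsum N (x t) + wsum N (x' t)) / 2.
Let mb t := (wsum N (y t) + wsum N (y' t)) / 2.
Let p t i := da t * mz t i + ma t * dz t i.
Let q t i := db t * mz t i + mb t * dz t i.

Let energy t : R := \sum_(i < N)
  weight i * s i / 2 * (dx t i ^+ 2 + dy t i ^+ 2 + dz t i ^+ 2).
Let cone t : R := energy t + eps * cross_form e N (dx t) (dy t).

Let denergy t : R := \sum_(i < N) weight i * (s i *
  (mz t i * (da t * dx t i + db t * dy t i) -
   dz t i * (da t * mx t i + db t * my t i))).
Let dcone t : R := denergy t + eps *
  (\sum_(i < N) weight i ^+ 2 * (dx t i ^+ 2 + dy t i ^+ 2) -
     (da t ^+ 2 + db t ^+ 2) - cross_rest e N (dx t) (dy t) (p t) (q t)).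

Let cone_derive t : is_derive t (1 : R) cone (dcone t).
Proof.
apply: is_derive_add; last first.
  apply: is_derive_scale; apply: (cross_form_derive e_inj) => i _.
    exact: x_diff_derive H H' t i.
  exact: y_diff_derive H H' t i.
apply: is_derive_sum_ord => i.
have D := is_derive_scale (weight i * s i / 2) (spin_sqdist_derive H H' t i).
apply: is_derive_eqfun D => //.
by rewrite /mx /my /mz /da /db /dx /dy /dz; field.
Qed.

Hypothesis win : forall t, 0 <= t -> polar_window s rad (x t) (y t) (z t).
Hypothesis win' : forall t, 0 <= t -> polar_window s rad (x' t) (y' t) (z' t).

Let S t : R := Num.sqrt (sqnorm2 N (dx t) (dy t)).

Let S_ge0 t : 0 <= S t. Proof. exact: sqrtr_ge0. Qed.

Let dxy_le t i : (i < N)%N -> `|dx t i| <= S t /\ `|dy t i| <= S t.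
Proof. by move=> iN; exact: norm_le_sqnorm2. Qed.

Let dz_le t i : 0 <= t -> (i < N)%N -> `|dz t i| <= S t.
Proof.
move=> t0 iN; have [a b] := win t0 iN; have [a' b'] := win' t0 iN.
have [_ _ _ E] := H t i; have [_ _ _ E'] := H' t i.
have [u v] := dxy_le t iN.
apply: le_trans (window_dz_le (ltW rad_gt0) (s1 i) E E' a a' b b' u v) _.
have r1 : 4 * rad <= 1 by move: rad_le4; lra.
by rewrite ler_piMl.
Qed.

Let mean_le t i : 0 <= t -> (i < N)%N ->
  [/\ `|mx t i| <= rad, `|my t i| <= rad, `|s i * mz t i - 1| <= rad & `|mz t i| <= 1].
Proof.
move=> t0 iN; have [a b] := win t0 iN; have [a' b'] := win' t0 iN.
have [_ _ _ E] := H t i; have [_ _ _ E'] := H' t i.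
have [? ?] := window_mean_le (ltW rad_gt0) a a'.
by have [] := window_mean_z (ltW rad_gt0) rad_le4 (s1 i) E E' a a' b b'.
Qed.

Let mab_le t : 0 <= t -> `|ma t| <= rad /\ `|mb t| <= rad.
Proof.
move=> t0.
have E (u v : nat -> R) : (wsum N u + wsum N v) / 2 = wsum N (fun i => (u i + v i) / 2).
  rewrite /wsum -big_split mulr_suml; apply: eq_bigr => i _ /=; ring.
rewrite /ma /mb !E; split; apply: wsum_le; rewrite ?(ltW rad_gt0)// => i iN.
  by have [] := mean_le t0 iN.
by have [] := mean_le t0 iN.
Qed.

Let dcone_ge t : 0 <= t -> eps * m / 4 * S t ^+ 2 <= dcone t.
Proof.
move=> t0; pose P := `|da t| + `|db t|; pose A := da t ^+ 2 + db t ^+ 2.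
have P0 : 0 <= P by rewrite addr_ge0.
have P2 : P ^+ 2 <= 2 * A.
  rewrite /P /A -(real_normK (num_real (da t))) -(real_normK (num_real (db t))).
  have := sqr_ge0 (`|da t| - `|db t|); lra.
have rest : `|cross_rest e N (dx t) (dy t) (p t) (q t)| <= C * (S t * (P + rad * S t)).
  apply: cross_rest_le => i iN; first exact: dxy_le.
  have [_ _ _ z1] := mean_le t0 iN; have dzS := dz_le t0 iN.
  have [ma1 mb1] := mab_le t0.
  have := ler_piMr (normr_ge0 (da t)) z1; have := ler_piMr (normr_ge0 (db t)) z1.
  have := ler_pM (normr_ge0 _) (normr_ge0 _) ma1 dzS.
  have := ler_pM (normr_ge0 _) (normr_ge0 _) mb1 dzS.
  move=> h1 h2 h3 h4; have := normr_ge0 (da t); have := normr_ge0 (db t) => h5 h6.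
  split; apply: le_trans (ler_normD _ _) _.
    by rewrite (normrM (da t)) (normrM (ma t)) /P; lra.
  by rewrite (normrM (db t)) (normrM (mb t)) /P; lra.
have rPS : 0 <= rad * (P * S t) := mulr_ge0 (ltW rad_gt0) (mulr_ge0 P0 (S_ge0 t)).
have en : A - 4 * rad * (P * S t) <= denergy t.
  (* [F] is the defect of the energy derivative from A, spin by spin: it vanishes when s mz = 1 and
     mx = my = 0, and is of order [rad] in the window. *)
  pose F i := s i * (mz t i * (da t * dx t i + db t * dy t i) -
     dz t i * (da t * mx t i + db t * my t i)) - (da t * dx t i + db t * dy t i).
  have FB i : (i < N)%N -> `|F i| <= 4 * rad * (P * S t).
    move=> iN; have [mx1 my1 z1 _] := mean_le t0 iN; have dzS := dz_le t0 iN.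
    have [dx1 dy1] := dxy_le t iN.
    have sn : `|s i| = 1 by apply/eqP; rewrite -sqrp_eq1// real_normK ?num_real// s1.
    have lin u v w : `|u| <= w -> `|v| <= w -> `|da t * u + db t * v| <= P * w.
      move=> uw vw; apply: le_trans (ler_normD _ _) _; rewrite !normrM /P mulrDl.
      by rewrite lerD// ler_wpM2l.
    have -> : F i = (s i * mz t i - 1) * (da t * dx t i + db t * dy t i) -
       s i * (dz t i * (da t * mx t i + db t * my t i)) by rewrite /F; ring.
    apply: le_trans (ler_normB _ _) _; rewrite !normrM sn mul1r.
    have := ler_pM (normr_ge0 _) (normr_ge0 _) z1 (lin _ _ _ dx1 dy1).
    have := ler_pM (normr_ge0 _) (normr_ge0 _) dzS (lin _ _ _ mx1 my1).
    move: rPS; lra.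
  have : `|wsum N F| <= 4 * rad * (P * S t).
    by apply: wsum_le => //; move: rPS; lra.
  have -> : wsum N F = denergy t - A.
    rewrite /F /wsum /denergy /A.
    have E : da t ^+ 2 + db t ^+ 2 = \sum_(i < N) weight i * (da t * dx t i + db t * dy t i).
      rewrite !expr2 {2}/da {2}/db /wsum !mulr_sumr -big_split.
      by apply: eq_bigr => i _ /=; ring.
    by rewrite E -sumrB; apply: eq_bigr => i _; rewrite mulrBr.
  by rewrite ler_norml => /andP[+ _]; lra.
have W := weighted_sqnorm2_ge N (dx t) (dy t); rewrite -/m in W.
have S2 : S t ^+ 2 = sqnorm2 N (dx t) (dy t) by rewrite sqr_sqrtr ?sqnorm2_ge0.
rewrite -S2 in W; rewrite /dcone.
move: W rest; set W0 := \sum_(i < N) _; set rst := cross_rest _ _ _ _ _ _.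
rewrite -/A ler_norml => W /andP[_ rest].
(* Young's inequality splits the cross terms between |U|^2 and |w|^2. *)
have y1 : C * (S t * P) <= m / 4 * S t ^+ 2 + 2 * (C ^+ 2 / m) * A.
  apply: (@le_trans _ _ (m / 4 * S t ^+ 2 + 2 * (C ^+ 2 / m) * (P ^+ 2 / 2))); last first.
    rewrite lerD2l ler_wpM2l//; first by rewrite mulr_ge0.
    by rewrite ler_pdivrMr// mulrC.
  rewrite -subr_ge0 (_ : _ - _ = (m * S t - 2 * C * P) ^+ 2 / (4 * m)); last first.
    by field; rewrite gt_eqF.
  by rewrite divr_ge0 ?sqr_ge0// mulr_ge0// ltW.
have y2 : 4 * rad * (P * S t) <= A / 2 + 16 * rad ^+ 2 * S t ^+ 2.
  have := sqr_ge0 (P / 2 - 4 * rad * S t); lra.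
have S20 : 0 <= S t ^+ 2 by rewrite sqr_ge0.
have y3 : 16 * rad ^+ 2 * S t ^+ 2 <= eps * m / 8 * S t ^+ 2.
  rewrite ler_wpM2r// expr2.
  have : rad * rad <= 4^-1 * rad by rewrite ler_pM2r.
  move: rad_le; lra.
have y4 : C * rad * S t ^+ 2 <= m / 8 * S t ^+ 2.
  rewrite ler_wpM2r//; apply: le_trans Crad_le _.
  have : eps * m <= 2^-1 * m by rewrite ler_pM2r.
  by move: m_gt0; lra.
have : eps * (W0 - A - rst) >=
    eps * (m / 2 * S t ^+ 2 - (1 + 2 * (C ^+ 2 / m)) * A).
  rewrite ler_pM2l//.
  have := ler_wpM2r S20 (ltW m_gt0).
  lra.
have : eps * ((1 + 2 * (C ^+ 2 / m)) * A) = A / 2 by rewrite mulrA epsE mulrC.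
have := mulr_ge0 (mulr_ge0 (ltW eps_gt0) (ltW m_gt0)) S20.
lra.
Qed.

Let cone_le t : 0 <= t -> cone t <= (1 + C) * S t ^+ 2.
Proof.
move=> t0.
have S20 : 0 <= S t ^+ 2 by rewrite sqr_ge0.
have h1 : `|cross_form e N (dx t) (dy t)| <= C * S t ^+ 2.
  by apply: cross_form_le => i; exact: dxy_le.
have h2 : eps * cross_form e N (dx t) (dy t) <= C * S t ^+ 2.
  apply: le_trans (ler_norm _) _; rewrite normrM gtr0_norm//.
  have eps1 : eps <= 1 by move: eps_le; lra.
  by apply: le_trans h1; rewrite ler_piMl.
suff : energy t <= 1 * S t ^+ 2 by rewrite /cone; lra.
have : `|wsum N (fun i => s i / 2 * (dx t i ^+ 2 + dy t i ^+ 2 + dz t i ^+ 2))| <= S t ^+ 2.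
  apply: wsum_le => // i iN.
  have sn : `|s i| = 1 by apply/eqP; rewrite -sqrp_eq1// real_normK ?num_real// s1.
  rewrite !normrM sn mul1r normfV (@ger0_norm _ 2)// ger0_norm ?addr_ge0 ?sqr_ge0//.
  have := sqr_le_sqnorm2 (dx t) (dy t) iN.
  have S2 : S t ^+ 2 = sqnorm2 N (dx t) (dy t) by rewrite sqr_sqrtr ?sqnorm2_ge0.
  rewrite -S2.
  have := dz_le t0 iN; rewrite -ler_sqr ?nnegrE// real_normK ?num_real//; lra.
rewrite mul1r; apply: le_trans; apply: le_trans (ler_norm _).
by rewrite /wsum /energy; apply: ler_sum => i _; rewrite !mulrA.
Qed.

(* A positive value of the cone form would make it grow at least linearly,
   although it is bounded. *)
Let cone_nonpos : cone 0 <= 0.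
Proof.
rewrite leNgt; apply/negP => c0.
have dpos t : 0 <= t -> 0 <= dcone t.
  move=> t0; apply: le_trans (dcone_ge t0).
  by rewrite mulr_ge0 ?sqr_ge0// divr_ge0// ltW// mulr_gt0.
have mono t : 0 <= t -> cone 0 <= cone t.
  move=> t0; apply: (derive_ge0_nondecreasing (df := dcone) t0) => u /andP[u0 _] //.
  exact: dpos.
(* [dcone_ge] and [cone_le] combine into dcone >= lam * cone. Since [cone] does not fall below its
   initial value, this already forces linear growth. *)
pose lam := eps * m / 4 / (1 + C).
have lam0 : 0 < lam by rewrite divr_gt0// divr_gt0// mulr_gt0.
have grow t : 0 <= t -> cone 0 * lam <= dcone t.
  move=> t0; apply: le_trans (dcone_ge t0).
  apply: (@le_trans _ _ (cone t * lam)); first by rewrite ler_pM2r// mono.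
  rewrite /lam mulrA ler_pdivrMr// (mulrC (cone t)) -[leRHS]mulrA.
  rewrite ler_pM2l; last by rewrite divr_gt0// mulr_gt0.
  by rewrite mulrC cone_le.
have lin t : 0 <= t -> cone 0 * lam * t <= cone t.
  move=> t0; have : (- cone) t - (- cone) 0 <= - (cone 0 * lam) * (t - 0).
    apply: (derive_ub (df := fun u => - dcone u) t0) => u /andP[u0 _].
      by apply: is_deriveN.
    by rewrite lerN2 grow.
  by rewrite !fctE; move: c0; lra.
pose B := (1 + C) * (8 * N%:R).
have bnd t : 0 <= t -> cone t <= B.
  move=> t0; apply: le_trans (cone_le t0) _; rewrite /B ler_pM2l//.
  rewrite sqr_sqrtr ?sqnorm2_ge0//.
  apply: (@le_trans _ _ (\sum_(i < N) 8)); last first.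
    by rewrite sumr_const card_ord -[8 *+ N]mulr_natr.
  apply: ler_sum => i _.
  have [x1 y1 _] := bloch_curve_le1 t i H; have [x1' y1' _] := bloch_curve_le1 t i H'.
  have two (u v : R) : `|u| <= 1 -> `|v| <= 1 -> (u - v) ^+ 2 <= 4.
    move=> u1 v1; have uv : `|u - v| <= 2 by have := ler_normB u v; lra.
    rewrite -(real_normK (num_real (u - v))).
    have := ler_pM (normr_ge0 _) (normr_ge0 _) uv uv; rewrite -expr2; lra.
  have := two _ _ x1 x1'; have := two _ _ y1 y1'; rewrite /dx /dy; lra.
have cl : 0 < cone 0 * lam by rewrite mulr_gt0.
pose t := (B + 1) / (cone 0 * lam).
have B0 : 0 <= B by rewrite !mulr_ge0// ltW.
have t0 : 0 <= t by rewrite divr_ge0 ?ltW//; lra.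
have tE : cone 0 * lam * t = B + 1 by rewrite /t mulrC divfK// gt_eqF.
by have := lin t t0; have := bnd t t0; rewrite tE; lra.
Qed.

Lemma single_spin_eq j : (j < N)%N -> s j = 1 ->
  (forall i, (i < N)%N -> i != j ->
    [/\ x 0 i = x' 0 i, y 0 i = y' 0 i & z 0 i = z' 0 i]) ->
  x 0 j = x' 0 j /\ y 0 j = y' 0 j.
Proof.
move=> jN sj agree.
have d0 i : (i < N)%N -> i != j -> [/\ dx 0 i = 0, dy 0 i = 0 & dz 0 i = 0].
  by move=> iN /(agree i iN)[]; rewrite /dx /dy /dz => -> -> ->; rewrite !subrr.
(* Each bracket of the cross form is antisymmetric in the two spins, so it vanishes when a single
   spin differs. Only the energy of spin j is left in the cone form, with the positive coefficient
   weight j / 2. *)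
have B0 : cross_form e N (dx 0) (dy 0) = 0.
  rewrite /cross_form big1 ?oppr0// => a _; rewrite big1// => b _.
  have [aj|aj] := eqVneq (a : nat) j; have [bj|bj] := eqVneq (b : nat) j.
  - by rewrite aj bj (mulrC (dy 0 j)) subrr mulr0.
  - by have [-> -> _] := d0 b (ltn_ord b) bj; rewrite !mulr0 subrr mulr0.
  - by have [-> -> _] := d0 a (ltn_ord a) aj; rewrite !mul0r subrr mulr0.
  - by have [-> -> _] := d0 b (ltn_ord b) bj; rewrite !mulr0 subrr mulr0.
have := cone_nonpos.
rewrite /cone B0 mulr0 addr0 /energy (bigD1 (Ordinal jN))//= sj big1; last first.
  move=> i ij; have [-> -> ->] := d0 i (ltn_ord i) ij.
  by rewrite expr0n/= !addr0 mulr0.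
rewrite addr0 mulr1 pmulr_rle0; last by rewrite divr_gt0// weight_gt0.
have := sqr_ge0 (dx 0 j); have := sqr_ge0 (dy 0 j); have := sqr_ge0 (dz 0 j).
move=> h1 h2 h3 h4.
have /eqP : dx 0 j ^+ 2 = 0 by lra.
have /eqP : dy 0 j ^+ 2 = 0 by lra.
by rewrite !sqrf_eq0 !subr_eq0 => /eqP -> /eqP ->.
Qed.

End pair.

(** The radius depends on e and N but not on the signs [s], so one radius serves all the pole
    configurations of the first N spins. *)
Lemma window_separation : exists2 r : R, 0 < r &
  forall s x y z x' y' z' j, (forall i, s i ^+ 2 = 1) ->
  bloch_curve e N x y z -> bloch_curve e N x' y' z' ->
  (forall t, 0 <= t -> polar_window s r (x t) (y t) (z t)) ->
  (forall t, 0 <= t -> polar_window s r (x' t) (y' t) (z' t)) ->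
  (j < N)%N -> s j = 1 ->
  (forall i, (i < N)%N -> i != j ->
    [/\ x 0 i = x' 0 i, y 0 i = y' 0 i & z 0 i = z' 0 i]) ->
  x 0 j = x' 0 j /\ y 0 j = y' 0 j.
Proof.
exists rad => // s x y z x' y' z' j s1 H H' W W'.
exact: (single_spin_eq s1 H H' W W').
Qed.

End cone.

(** * Solutions in coordinates *)

Section solutions.
Context {R : realType}.
Implicit Types (e : nat -> R) (N : nat) (X Y : state R) (Xi : R -> state R).

Lemma is_derive_mxP m n (f : R -> 'M[R]_(m, n)) (t : R) (D : 'M[R]_(m, n)) :
  is_derive t (1 : R) f D <->
  forall i j, is_derive t (1 : R) (fun s => f s i j) (D i j).
Proof.
split=> [[fd fD] i j|fD].
  split; first exact: (derivable_mxP f t 1).1.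
  by rewrite -fD derive_mx// mxE.
have fd : derivable f t 1 by apply/derivable_mxP => i j; have [] := fD i j.
split => //; rewrite derive_mx//; apply/matrixP => i j; rewrite mxE.
by have [] := fD i j.
Qed.

Let ord3 (P : 'I_3 -> Prop) : P 0 -> P 1 -> P 2 -> forall i, P i.
Proof.
by move=> p0 p1 p2 [[|[|[|//]]] i3]; [move: p0|move: p1|move: p2];
  congr P; apply: val_inj.
Qed.

Lemma sphere2_sqnorm (p : sphere2 R) :
  xcoord p ^+ 2 + ycoord p ^+ 2 + zcoord p ^+ 2 = 1.
Proof. by rewrite -sqr_enorm enorm_sphere2 expr1n. Qed.

Lemma fieldE e X (u : R * R) i :
  [/\ field e X u i 0 0 = - e i * ycoord (X i) + u.2 * zcoord (X i),
      field e X u i 1 0 = e i * xcoord (X i) + u.1 * zcoord (X i) &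
      field e X u i 2 0 = - u.2 * xcoord (X i) - u.1 * ycoord (X i)].
Proof.
have E1 : lift ord0 ord0 = 1 :> 'I_3 by apply: val_inj.
have E2 : lift ord0 (lift ord0 ord0) = 2 :> 'I_3 by apply: val_inj.
by split; rewrite /field !mxE !big_ord_recl big_ord0 !mxE/= E1 E2
  /xcoord /ycoord /zcoord; ring.
Qed.

Lemma ivp_solutionP e N X Xi :
  ivp_solution e (truncated_feedback N) X Xi <->
  Xi 0 = X /\ bloch_curve e N (fun t i => xcoord (Xi t i))
    (fun t i => ycoord (Xi t i)) (fun t i => zcoord (Xi t i)).
Proof.
split=> [[H0 H]|[H0 H]]; split => // t i.
  have /is_derive_mxP D := H t i.
  have [Ex Ey Ez] := fieldE e (Xi t) (truncated_feedback N (Xi t)) i.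
  split; last exact: sphere2_sqnorm.
  - by rewrite -Ex; exact: (D 0 0).
  - by rewrite -Ey; exact: (D 1 0).
  - by rewrite -Ez; exact: (D 2 0).
apply/is_derive_mxP => k j; rewrite (ord1 j).
have [dx dy dz _] := H t i; have [Ex Ey Ez] := fieldE e (Xi t) (truncated_feedback N (Xi t)) i.
by move: k; apply: ord3; [rewrite Ex|rewrite Ey|rewrite Ez].
Qed.

End solutions.

(** * Existence of solutions *)

Section retraction.
Context {R : realType}.
Implicit Types (u x y z n d : R).

Let norm_le_amgm u n : u ^+ 2 <= n -> `|u| <= (1 + n) / 2.
Proof.
move=> un; have := sqr_ge0 (`|u| - 1).
have := real_normK (num_real u); lra.
Qed.

Lemma retraction_le1 u n : u ^+ 2 <= n -> `|2 * u / (1 + n)| <= 1.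
Proof.
move=> un; have n0 : 0 <= n := le_trans (sqr_ge0 u) un.
have n1 : 0 < 1 + n by lra.
rewrite normrM normfV (gtr0_norm n1) ler_pdivrMr// mul1r normrM (@ger0_norm _ 2)//.
by have := norm_le_amgm un; lra.
Qed.

Lemma retraction_lipschitz u u' x y z x' y' z' d :
  let n := x ^+ 2 + y ^+ 2 + z ^+ 2 in
  let n' := x' ^+ 2 + y' ^+ 2 + z' ^+ 2 in
  u ^+ 2 <= n -> u' ^+ 2 <= n' -> `|u - u'| <= d ->
  `|x - x'| <= d -> `|y - y'| <= d -> `|z - z'| <= d ->
  `|2 * u / (1 + n) - 2 * u' / (1 + n')| <= 10 * d.
Proof.
move=> n n' un un' du dx dy dz.
have d0 : 0 <= d := le_trans (normr_ge0 _) du.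
have [[x2 y2] z2] := (sqr_ge0 x, sqr_ge0 y, sqr_ge0 z).
have [[x2' y2'] z2'] := (sqr_ge0 x', sqr_ge0 y', sqr_ge0 z').
have n0 : 0 <= n by rewrite /n; lra.
have n0' : 0 <= n' by rewrite /n'; lra.
have n1 : 0 < 1 + n by lra.
have n1' : 0 < 1 + n' by lra.
pose D := (1 + n) * (1 + n').
have D0 : 0 < D by rewrite mulr_gt0.
have nn := mulr_ge0 n0 n0'.
have -> : 2 * u / (1 + n) - 2 * u' / (1 + n') =
    2 * ((u - u') * (1 + n') - u' * (n - n')) / D.
  by rewrite /D; field; rewrite !gt_eqF.
rewrite normrM normfV (gtr0_norm D0) ler_pdivrMr// normrM (@ger0_norm _ 2)//.
have t1 : `|(u - u') * (1 + n')| <= d * D.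
  rewrite normrM (gtr0_norm n1') ler_pM//; [exact: ltW|rewrite /D; lra].
(* The inequality of arithmetic and geometric means gives |u'| |v| <= D / 4, and |u'| |v'| <= n' <=
   D, whence 5 / 4. In total 2 (1 + 3 * 5 / 4) = 19 / 2, below the announced 10. *)
have t2 v v' : v ^+ 2 <= n -> v' ^+ 2 <= n' -> `|v - v'| <= d ->
    `|u' * (v ^+ 2 - v' ^+ 2)| <= d * (5 / 4 * D).
  move=> vn vn' dv.
  have -> : u' * (v ^+ 2 - v' ^+ 2) = (v - v') * (u' * (v + v')) by ring.
  rewrite normrM ler_pM// normrM.
  have a1 : `|u'| * `|v'| <= n'.
    have := sqr_ge0 (`|u'| - `|v'|).
    have := real_normK (num_real u'); have := real_normK (num_real v'); lra.
  have a2 : `|u'| * `|v| <= (1 + n') / 2 * ((1 + n) / 2).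
    by rewrite ler_pM// norm_le_amgm.
  apply: (@le_trans _ _ (`|u'| * (`|v| + `|v'|))); first by rewrite ler_wpM2l// ler_normD.
  rewrite /D; lra.
have xn : x ^+ 2 <= n by rewrite /n; lra.
have yn : y ^+ 2 <= n by rewrite /n; lra.
have zn : z ^+ 2 <= n by rewrite /n; lra.
have xn' : x' ^+ 2 <= n' by rewrite /n'; lra.
have yn' : y' ^+ 2 <= n' by rewrite /n'; lra.
have zn' : z' ^+ 2 <= n' by rewrite /n'; lra.
have := t2 _ _ xn xn' dx; have := t2 _ _ yn yn' dy; have := t2 _ _ zn zn' dz.
have -> : u' * (n - n') = u' * (x ^+ 2 - x' ^+ 2) + u' * (y ^+ 2 - y' ^+ 2) +
    u' * (z ^+ 2 - z' ^+ 2) by rewrite /n /n'; ring.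
set a := u' * _; set b := u' * _; set c := u' * _ => ha hb hc.
have := ler_normB ((u - u') * (1 + n')) (c + b + a).
have := ler_normD (c + b) a; have := ler_normD c b.
have := mulr_ge0 d0 (ltW D0); lra.
Qed.

End retraction.

Section existence.
Context {R : realType} (e : nat -> R) (E : R) (e_le : forall i, `|e i| <= E).
Variable N : nat.

Let I : Type := (nat * 'I_3)%type.
Implicit Types (V W : I -> R).

Let sqn V i : R := V (i, 0) ^+ 2 + V (i, 1) ^+ 2 + V (i, 2) ^+ 2.

(* The retraction v |-> 2v / (1 + |v|^2) onto the unit ball is the identity on
   the sphere; composing with it makes the field bounded and Lipschitz while
   keeping it tangent to the spheres. *)
Let rho V (c : 'I_3) i : R := 2 * V (i, c) / (1 + sqn V i).

Let f (k : I) V : R :=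
  let i := k.1 in
  let a := wsum N (rho V 0) in let b := wsum N (rho V 1) in
  if k.2 == 0 then - e i * rho V 1 i + a * rho V 2 i
  else if k.2 == 1 then e i * rho V 0 i + b * rho V 2 i
  else - a * rho V 0 i - b * rho V 1 i.

Let sq_le_sqn V i c : V (i, c) ^+ 2 <= sqn V i.
Proof.
have [[x2 y2] z2] := (sqr_ge0 (V (i, 0)), sqr_ge0 (V (i, 1)), sqr_ge0 (V (i, 2))).
rewrite /sqn; case: c => [[|[|[|//]]] c3].
- by rewrite (_ : Ordinal c3 = 0); [lra|apply: val_inj].
- by rewrite (_ : Ordinal c3 = 1); [lra|apply: val_inj].
- by rewrite (_ : Ordinal c3 = 2); [lra|apply: val_inj].
Qed.

Let rho_le1 V c i : `|rho V c i| <= 1.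
Proof. exact: retraction_le1 (sq_le_sqn V i c). Qed.

Let rho_lip V W d c i : (forall k, `|V k - W k| <= d) ->
  `|rho V c i - rho W c i| <= 10 * d.
Proof. by move=> H; apply: retraction_lipschitz => //; exact: sq_le_sqn. Qed.

Let wsum_le1 V c : `|wsum N (rho V c)| <= 1.
Proof. exact: wsum_le. Qed.

Let wsum_lip V W d c : (forall k, `|V k - W k| <= d) ->
  `|wsum N (rho V c) - wsum N (rho W c)| <= 10 * d.
Proof.
move=> H; rewrite -wsumB; apply: wsum_le => [i _|]; first exact: rho_lip.
by rewrite mulr_ge0// (le_trans (normr_ge0 _) (H (0%N, 0))).
Qed.

Let E_ge0 : 0 <= E. Proof. exact: le_trans (normr_ge0 _) (e_le 0). Qed.

Let f_bounded k V : `|f k V| <= E + 2.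
Proof.
have mul (a b A : R) : `|a| <= A -> `|b| <= 1 -> `|a * b| <= A.
  move=> aA b1; rewrite normrM -[A]mulr1; exact: ler_pM.
have Ne i : `|- e i| <= E by rewrite normrN.
have Nw c : `|- wsum N (rho V c)| <= 1 by rewrite normrN.
have E0 : 0 <= E := E_ge0.
rewrite /f; case: ifP => _; [|case: ifP => _].
- apply: le_trans (ler_normD _ _) _.
  have := mul _ _ _ (Ne k.1) (rho_le1 V 1 k.1).
  have := mul _ _ _ (wsum_le1 V 0) (rho_le1 V 2 k.1); lra.
- apply: le_trans (ler_normD _ _) _.
  have := mul _ _ _ (e_le k.1) (rho_le1 V 0 k.1).
  have := mul _ _ _ (wsum_le1 V 1) (rho_le1 V 2 k.1); lra.
- apply: le_trans (ler_normB _ _) _.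
  have := mul _ _ _ (Nw 0) (rho_le1 V 0 k.1).
  have := mul _ _ _ (wsum_le1 V 1) (rho_le1 V 1 k.1); lra.
Qed.

Let f_lipschitz k V W (d : R) : (forall j, `|V j - W j| <= d) ->
  `|f k V - f k W| <= (10 * E + 40) * d.
Proof.
move=> H; have d0 : 0 <= d := le_trans (normr_ge0 _) (H (0%N, 0)).
have rl c i := @rho_lip V W d c i H.
have wl c := @wsum_lip V W d c H.
have lin (a b b' A : R) : `|a| <= A -> `|b - b'| <= 10 * d ->
    `|a * b - a * b'| <= A * (10 * d).
  move=> aA bb; rewrite -mulrBr normrM; exact: ler_pM.
have prod (a a' b b' : R) : `|a'| <= 1 -> `|b| <= 1 -> `|a - a'| <= 10 * d ->
    `|b - b'| <= 10 * d -> `|a * b - a' * b'| <= 20 * d.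
  move=> a1 b1 aa bb.
  have -> : a * b - a' * b' = (a - a') * b + (a' * b - a' * b') by ring.
  apply: le_trans (ler_normD _ _) _.
  have := lin _ _ _ _ a1 bb.
  have := ler_pM (normr_ge0 _) (normr_ge0 _) aa b1; rewrite -normrM; lra.
have Ne i : `|- e i| <= E by rewrite normrN.
have Ed : 0 <= E * d := mulr_ge0 E_ge0 d0.
rewrite /f; case: ifP => _; [|case: ifP => _].
- rewrite opprD addrACA; apply: le_trans (ler_normD _ _) _.
  have := lin _ _ _ _ (Ne k.1) (rl 1 k.1).
  have := prod _ _ _ _ (wsum_le1 W 0) (rho_le1 V 2 k.1) (wl 0) (rl 2 k.1); lra.
- rewrite opprD addrACA; apply: le_trans (ler_normD _ _) _.
  have := lin _ _ _ _ (e_le k.1) (rl 0 k.1).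
  have := prod _ _ _ _ (wsum_le1 W 1) (rho_le1 V 2 k.1) (wl 1) (rl 2 k.1); lra.
- rewrite -normrN [X in `|X|](_ : _ =
    wsum N (rho V 0) * rho V 0 k.1 - wsum N (rho W 0) * rho W 0 k.1 +
    (wsum N (rho V 1) * rho V 1 k.1 - wsum N (rho W 1) * rho W 1 k.1)); last by ring.
  apply: le_trans (ler_normD _ _) _.
  have := prod _ _ _ _ (wsum_le1 W 0) (rho_le1 V 0 k.1) (wl 0) (rl 0 k.1).
  have := prod _ _ _ _ (wsum_le1 W 1) (rho_le1 V 1 k.1) (wl 1) (rl 1 k.1); lra.
Qed.

Lemma ivp_solution_exists (X : state R) :
  exists Xi, ivp_solution e (truncated_feedback N) X Xi.
Proof.
have L0 : 0 < 10 * E + 40 by have E0 : 0 <= E := E_ge0; lra.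
have [Y [Y0 dY]] := picard_existence
  (fun k => sphere2_val (X k.1) k.2 0) L0 f_bounded f_lipschitz.
have d0 t i : is_derive t (1 : R) (fun s => Y s (i, 0))
    (- e i * rho (Y t) 1 i + wsum N (rho (Y t) 0) * rho (Y t) 2 i) := dY t (i, 0).
have d1 t i : is_derive t (1 : R) (fun s => Y s (i, 1))
    (e i * rho (Y t) 0 i + wsum N (rho (Y t) 1) * rho (Y t) 2 i) := dY t (i, 1).
have d2 t i : is_derive t (1 : R) (fun s => Y s (i, 2))
    (- wsum N (rho (Y t) 0) * rho (Y t) 0 i - wsum N (rho (Y t) 1) * rho (Y t) 1 i) := dY t (i, 2).
(* The three coordinates of [rho] are one common multiple of those of [Y], so the modified velocity
   is orthogonal to [Y] and the norm is conserved even before [rho] is known to be the identity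
   there. *)
have nY t i : sqn (Y t) i = 1.
  have <- : sqn (Y 0) i = 1 by rewrite Y0; exact: sphere2_sqnorm.
  apply: (@is_derive_0_is_cst R (fun t => sqn (Y t) i)) => s.
  apply: is_derive_eqfun (is_derive_add (is_derive_add
    (is_derive_mul (d0 s i) (d0 s i)) (is_derive_mul (d1 s i) (d1 s i)))
    (is_derive_mul (d2 s i) (d2 s i))).
    by move=> u; rewrite /sqn !expr2.
  by rewrite /rho; ring.
have rY t c : rho (Y t) c = fun i => Y t (i, c).
  apply/funext => i; rewrite /rho nY mulrAC divff ?mul1r//.
  by rewrite pnatr_eq0.
pose v t i : 'cV[R]_3 := \col_(c < 3) Y t (i, c).
have v1 t i : enorm (v t i) == 1 by rewrite enormE !mxE -/(sqn (Y t) i) nY sqrtr1.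
exists (fun t i => Sphere2 (v1 t i)); apply/ivp_solutionP; split.
  apply/funext => i; apply/val_inj/matrixP => c j.
  by rewrite (ord1 j) /= mxE Y0.
have xE (c : 'I_3) : (fun t i => v t i c 0) = (fun t i => Y t (i, c)).
  by apply/funext => t; apply/funext => i; rewrite mxE.
rewrite /xcoord /ycoord /zcoord /= !xE => t i; split; last exact: nY.
- by have := d0 t i; rewrite !rY.
- by have := d1 t i; rewrite !rY.
- by have := d2 t i; rewrite !rY.
Qed.

End existence.

(** * The flow *)

Section gronwall.
Context {R : realType}.

(** The bound on the absolute value of the derivative makes the estimate valid backwards in time,
    where it controls the return from a late perturbation to the initial state. *)
Lemma gronwall (f df : R -> R) (c t : R) :
  (forall s, is_derive s (1 : R) f (df s)) ->
  (forall s, `|df s| <= c * f s) -> f t <= expR (c * `|t|) * f 0.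
Proof.
move=> fdf dfc.
suff H (g dg : R -> R) s : 0 <= s -> (forall s, is_derive s (1 : R) g (dg s)) ->
    (forall s, dg s <= c * g s) -> g s <= expR (c * s) * g 0.
  have [t0|/ltW t0] := leP 0 t.
    rewrite (ger0_norm t0); apply: (H f df) => // s.
    exact: le_trans (ler_norm _) (dfc s).
  have Nt : 0 <= - t by rewrite oppr_ge0.
  rewrite (ler0_norm t0); have := H (fun s => f (- s)) (fun s => - df (- s)) _ Nt.
  rewrite opprK oppr0; apply => s; first exact: is_derive_reflect.
  by apply: le_trans (ler_norm _) _; rewrite normrN.
move=> s0 gdg dgc.
have D u : is_derive u (1 : R) (fun v => expR (- c * v) * g v)
    (- c * expR (- c * u) * g u + expR (- c * u) * dg u).
  exact: is_derive_mul (is_derive_expRM _ _) (gdg u).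
have : expR (- c * s) * g s - expR (- c * 0) * g 0 <= 0 * (s - 0).
  apply: (derive_ub s0 (fun u _ => D u)) => u _.
  rewrite (_ : _ + _ = expR (- c * u) * (dg u - c * g u)); last by ring.
  by rewrite pmulr_rle0 ?expR_gt0// subr_le0.
rewrite mul0r mulr0 expR0 mul1r subr_le0 mulNr expRN => h.
by rewrite -ler_pdivrMl ?expR_gt0.
Qed.

End gronwall.

(** * The product metric and its finite truncations *)

Section state_metric.
Context {R : realType}.
Implicit Types X Y : state R.

Definition spin_sqdist (p q : sphere2 R) : R :=
  (xcoord p - xcoord q) ^+ 2 + (ycoord p - ycoord q) ^+ 2 + (zcoord p - zcoord q) ^+ 2.

Definition sqdist (M : nat) X Y : R := \sum_(i < M) spin_sqdist (X i) (Y i).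

Lemma spin_sqdistE p q :
  spin_sqdist p q = enorm (sphere2_val p - sphere2_val q) ^+ 2.
Proof. by rewrite sqr_enorm !mxE. Qed.

Lemma spin_sqdist_ge0 p q : 0 <= spin_sqdist p q.
Proof. by rewrite spin_sqdistE sqr_ge0. Qed.

Lemma spin_sqdist_eq0 p q : spin_sqdist p q = 0 -> p = q.
Proof.
rewrite spin_sqdistE => /eqP; rewrite sqrf_eq0 => /eqP/enorm_eq0/eqP.
by rewrite subr_eq0 => /eqP/val_inj.
Qed.

Lemma sqdist_ge0 M X Y : 0 <= sqdist M X Y.
Proof. by apply: sumr_ge0 => i _; exact: spin_sqdist_ge0. Qed.

Lemma spin_sqdist_le M X Y i : (i < M)%N ->
  spin_sqdist (X i) (Y i) <= sqdist M X Y.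
Proof.
move=> iM; rewrite /sqdist (bigD1 (Ordinal iM))//= lerDl.
by apply: sumr_ge0 => j _; exact: spin_sqdist_ge0.
Qed.

Lemma weight_enorm_le X Y i :
  weight i * enorm (sphere2_val (X i) - sphere2_val (Y i)) <= mdist X Y.
Proof.
have t0 j : 0 <= weight j * enorm (sphere2_val (X j) - sphere2_val (Y j)).
  by rewrite mulr_ge0 ?weight_ge0 ?enorm_ge0.
have nd : nondecreasing_seq (series
    (fun i => weight i * enorm (sphere2_val (X i) - sphere2_val (Y i)))).
  by apply/nondecreasing_series => n _ _; exact: t0.
have dE : mdist X Y = limn (series
    (fun i => weight i * enorm (sphere2_val (X i) - sphere2_val (Y i)))) by [].
rewrite dE; apply: le_trans (nondecreasing_cvgn_le nd (@is_cvg_state_dist R X Y) i.+1).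
by rewrite /series/= big_nat_recr//= lerDr sumr_ge0.
Qed.

Lemma sqdist_le_mdist M X Y :
  sqdist M X Y <= M%:R * (mdist X Y / weight M) ^+ 2.
Proof.
apply: (@le_trans _ _ (\sum_(i < M) (mdist X Y / weight M) ^+ 2)); last first.
  by rewrite sumr_const card_ord mulr_natl.
apply: ler_sum => i _; rewrite spin_sqdistE.
have d0 : 0 <= mdist X Y by exact: mdist_ge0.
rewrite ler_sqr ?nnegrE ?enorm_ge0 ?divr_ge0 ?weight_ge0//.
rewrite ler_pdivlMr ?weight_gt0//; apply: le_trans (weight_enorm_le X Y i).
by rewrite mulrC ler_wpM2r ?enorm_ge0 ?weight_le// ltnW.
Qed.

(** The first M weights add up to at most 1, and the spins beyond M, at distance at most 2 each,
    carry total weight 2^-M. *)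
Lemma mdist_le_sqdist M X Y :
  mdist X Y <= Num.sqrt (sqdist M X Y) + 2 * 2 ^- M.
Proof.
pose d i := enorm (sphere2_val (X i) - sphere2_val (Y i)).
pose s := Num.sqrt (sqdist M X Y).
have s0 : 0 <= s := sqrtr_ge0 _.
have d0 i : 0 <= d i := enorm_ge0 _.
have dM : wsum M d <= s.
  apply: le_trans (ler_norm _) _; apply: wsum_le => // i iM.
  rewrite ger0_norm//.
  have -> : d i = Num.sqrt (d i ^+ 2) by rewrite sqrtr_sqr ger0_norm.
  by rewrite ler_wsqrtr// -spin_sqdistE spin_sqdist_le.
have d2 i : d i <= 2.
  by apply: le_trans (enormD _ _) _; rewrite enormN !enorm_sphere2; lra.
have H k : wsum (k + M) d <= s + 2 * (2 ^- M - 2 ^- (k + M)).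
  elim: k => [|k IH]; first by rewrite subrr mulr0 addr0.
  rewrite addSn /wsum big_ord_recr /= -/(wsum _ _).
  have := ler_wpM2l (weight_ge0 (R := R) (k + M)) (d2 (k + M)%N).
  have -> : weight (k + M) = 2^-1 * 2 ^- (k + M) :> R by rewrite /weight exprS invfM.
  have -> : 2 ^- (k + M).+1 = 2^-1 * 2 ^- (k + M) :> R by rewrite exprS invfM.
  move: IH; lra.
apply: limr_le; first exact: (@is_cvg_state_dist R X Y).
exists M => // n /= Mn; rewrite -(subnK Mn) /series /= big_mkord.
apply: le_trans (H _) _; rewrite -/s lerD2l ler_pM2l// gerBl.
by rewrite invr_ge0 exprn_ge0.
Qed.

End state_metric.

Section flow.
Context {R : realType} (e : nat -> R) (E : R) (e_le : forall i, `|e i| <= E).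
Implicit Types (X Y : state R) (N M : nat).

(** The feedback reads the first N spins, so for M >= N the first M spins form a closed system. Each
    of them contributes at most 2 (2 + 2) = 8 times the squared distance to the derivative. *)
Lemma solution_sqdist_le N M X Y Xi Yi t : (N <= M)%N ->
  ivp_solution e (truncated_feedback N) X Xi ->
  ivp_solution e (truncated_feedback N) Y Yi ->
  sqdist M (Xi t) (Yi t) <= expR (8 * M%:R * `|t|) * sqdist M X Y.
Proof.
move=> NM /ivp_solutionP[<- H] /ivp_solutionP[<- H'].
apply: (@gronwall _ (fun s => sqdist M (Xi s) (Yi s))) => s.
  by apply: is_derive_sum_ord => i; exact: (spin_sqdist_derive H H' s i).
set S := sqdist _ _ _; pose T := Num.sqrt S.
have T0 : 0 <= T := sqrtr_ge0 _.
have T2 : T * T = S by rewrite -expr2 sqr_sqrtr ?sqdist_ge0.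
have ST i : (i < M)%N -> [/\ `|xcoord (Xi s i) - xcoord (Yi s i)| <= T,
   `|ycoord (Xi s i) - ycoord (Yi s i)| <= T & `|zcoord (Xi s i) - zcoord (Yi s i)| <= T].
  move=> iM; have := spin_sqdist_le (Xi s) (Yi s) iM; rewrite -/S /spin_sqdist => h.
  set u := xcoord _ - _ in h *; set v := ycoord _ - _ in h *; set w := zcoord _ - _ in h *.
  have [[u0 v0] w0] := (sqr_ge0 u, sqr_ge0 v, sqr_ge0 w).
  by split; rewrite -sqrtr_sqr ler_wsqrtr//; lra.
have aT : `|wsum N (fun i => xcoord (Xi s i) - xcoord (Yi s i))| <= T.
  by apply: wsum_le => // i iN; have [] := ST i (leq_trans iN NM).
have bT : `|wsum N (fun i => ycoord (Xi s i) - ycoord (Yi s i))| <= T.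
  by apply: wsum_le => // i iN; have [] := ST i (leq_trans iN NM).
apply: le_trans (ler_norm_sum _ _ _) _.
apply: (@le_trans _ _ (\sum_(i < M) (8 * S))); last first.
  by rewrite sumr_const card_ord -[leLHS]mulr_natr mulrAC.
apply: ler_sum => i _; have [dx dy dz] := ST i (ltn_ord i).
have [x1 y1 z1] := bloch_curve_le1 s i H; have [x1' y1' z1'] := bloch_curve_le1 s i H'.
have mean (u v : R) : `|u| <= 1 -> `|v| <= 1 -> `|(u + v) / 2| <= 1.
  rewrite !ler_norml => /andP[? ?] /andP[? ?]; apply/andP; split; lra.
have mx := mean _ _ x1 x1'; have my := mean _ _ y1 y1'; have mz := mean _ _ z1 z1'.
move: aT bT dx dy dz mx my mz.
set a := wsum _ _; set b := wsum _ _; set dx := _ - _; set dy := _ - _; set dz := _ - _.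
set mx := _ / 2; set my := _ / 2; set mz := _ / 2.
clearbody a b dx dy dz mx my mz => aT bT dxT dyT dzT mx1 my1 mz1.
have lin (u v K : R) : `|u| <= K -> `|v| <= K -> `|a * u + b * v| <= 2 * (T * K).
  move=> uK vK; apply: le_trans (ler_normD _ _) _; rewrite !normrM.
  have := ler_pM (normr_ge0 _) (normr_ge0 _) aT uK.
  have := ler_pM (normr_ge0 _) (normr_ge0 _) bT vK; lra.
rewrite normrM (@ger0_norm _ 2)//.
have := ler_normB (mz * (a * dx + b * dy)) (dz * (a * mx + b * my)).
have := ler_pM (normr_ge0 _) (normr_ge0 _) mz1 (lin _ _ _ dxT dyT).
have := ler_pM (normr_ge0 _) (normr_ge0 _) dzT (lin _ _ _ mx1 my1).
rewrite -!normrM T2; lra.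
Qed.

Definition flow N X : R -> state R := projT1 (cid (ivp_solution_exists e_le N X)).

Lemma flowP N X : ivp_solution e (truncated_feedback N) X (flow N X).
Proof. by rewrite /flow; case: cid. Qed.

Lemma flow_unique N X Xi :
  ivp_solution e (truncated_feedback N) X Xi -> flow N X = Xi.
Proof.
move=> H; apply/funext => t; apply/funext => i; apply: spin_sqdist_eq0.
apply/eqP; rewrite eq_le spin_sqdist_ge0 andbT.
(* A truncation that contains both spin i and all the spins read by the feedback. *)
have iM : (i < N + i.+1)%N by rewrite addnS ltnS leq_addl.
apply: le_trans (spin_sqdist_le _ _ iM) _.
apply: le_trans (solution_sqdist_le t (leq_addr _ _) (flowP N X) H) _.
rewrite (_ : sqdist _ X X = 0) ?mulr0//; apply: big1 => j _.
by rewrite /spin_sqdist !subrr expr0n/= !addr0.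
Qed.

Lemma flow0 N X : flow N X 0 = X.
Proof. by have [] := flowP N X. Qed.

Lemma flow_curve N X : bloch_curve e N (fun t i => xcoord (flow N X t i))
  (fun t i => ycoord (flow N X t i)) (fun t i => zcoord (flow N X t i)).
Proof. by have /ivp_solutionP[] := flowP N X. Qed.

Lemma flowD N X s t : flow N (flow N X t) s = flow N X (s + t).
Proof.
suff -> : flow N (flow N X t) = fun s => flow N X (s + t) by [].
apply: flow_unique; apply/ivp_solutionP; split; first by rewrite add0r.
move=> u i; have [dx dy dz E1] := flow_curve N X (u + t) i.
by split => //; [exact: is_derive_shift dx|exact: is_derive_shift dy|exact: is_derive_shift dz].
Qed.

Lemma flow_sqdist_le N M X Y t : (N <= M)%N ->
  sqdist M (flow N X t) (flow N Y t) <= expR (8 * M%:R * `|t|) * sqdist M X Y.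
Proof. by move=> NM; exact: solution_sqdist_le (flowP N X) (flowP N Y). Qed.

End flow.

(** * Generic initial states *)

Section sphere_perturbation.
Context {R : realType}.

Lemma sphere2_of_coords (a b c : R) : a ^+ 2 + b ^+ 2 + c ^+ 2 = 1 ->
  exists q : sphere2 R, [/\ xcoord q = a, ycoord q = b & zcoord q = c].
Proof.
move=> abc; pose v : 'cV[R]_3 := \col_(i < 3) [:: a; b; c]`_i.
have v1 : enorm v == 1 by rewrite enormE !mxE/= abc sqrtr1.
by exists (Sphere2 v1); rewrite /xcoord /ycoord /zcoord /= !mxE.
Qed.

Lemma sphere2_perturb (p : sphere2 R) (eta : R) : 2^-1 <= zcoord p -> 0 < eta ->
  exists2 q : sphere2 R, spin_sqdist p q <= eta & xcoord p <> xcoord q.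
Proof.
move=> z2 eta0; have E := sphere2_sqnorm p.
set x := xcoord p in E *; set y := ycoord p in E *; set z := zcoord p in z2 E *.
(* The point moves by h in x, and z is readjusted to the sphere. The bound 1 / 24 keeps the new z^2
   nonnegative: it changes by at most 3 h <= 1 / 8, while z^2 >= 1 / 4. Then |z - c| <= 6 h, so the
   squared distance is at most (1 + 36) h^2 <= 37 h. *)
pose h := Num.min 24^-1 (eta / 37).
have h0 : 0 < h by rewrite lt_min invr_gt0 divr_gt0//= ltr0n.
have h24 : h <= 24^-1 by rewrite ge_min lexx.
have heta : 37 * h <= eta by rewrite mulrC -ler_pdivlMr// ge_min lexx orbT.
have x1 : `|x| <= 1.
  rewrite -ler_sqr ?nnegrE// expr1n real_normK ?num_real//.
  by have := sqr_ge0 y; have := sqr_ge0 z; lra.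
have hh : h * h <= h by rewrite ler_piMl//; [exact: ltW|lra].
have hh0 : 0 <= h * h by rewrite mulr_ge0// ltW.
have d3 : `|2 * x * h + h * h| <= 3 * h.
  apply: le_trans (ler_normD _ _) _; rewrite !normrM (gtr0_norm h0) (@ger0_norm _ 2)//.
  have : `|x| * h <= 1 * h by rewrite ler_pM2r.
  lra.
have zz : 4^-1 <= z ^+ 2.
  have : 2^-1 * 2^-1 <= z * z by rewrite ler_pM ?invr_ge0.
  by rewrite -expr2; lra.
pose c2 := z ^+ 2 - (2 * x * h + h * h).
have c20 : 0 <= c2.
  by move: d3; rewrite /c2 ler_norml => /andP[]; lra.
pose c := Num.sqrt c2; have c0 : 0 <= c := sqrtr_ge0 _.
have cc : c ^+ 2 = c2 by rewrite sqr_sqrtr.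
have [q [qx qy qz]] : exists q : sphere2 R,
    [/\ xcoord q = x + h, ycoord q = y & zcoord q = c].
  by apply: sphere2_of_coords; rewrite cc /c2; move: E; lra.
exists q; last by rewrite qx -/x => xh; lra.
rewrite /spin_sqdist qx qy qz -/x -/y -/z.
have cz : `|z - c| <= 6 * h.
  have : `|(z - c) * (z + c)| <= 3 * h.
    by rewrite (_ : _ * _ = 2 * x * h + h * h)//; rewrite -subr_sqr cc /c2; ring.
  rewrite normrM (@ger0_norm _ (z + c)); last by lra.
  have : `|z - c| * 2^-1 <= `|z - c| * (z + c) by rewrite ler_wpM2l//; lra.
  lra.
have : (z - c) ^+ 2 <= 36 * (h * h).
  rewrite -(real_normK (num_real (z - c))).
  have := ler_pM (normr_ge0 _) (normr_ge0 _) cz cz; rewrite -expr2; lra.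
rewrite subrr expr0n/= addr0 (_ : x - (x + h) = - h); last by ring.
rewrite sqrrN expr2; lra.
Qed.

End sphere_perturbation.

Section window_sets.
Context {R : realType}.

Definition state_window N (s : nat -> R) (r : R) (p : state R) : Prop :=
  polar_window N s r (xcoord \o p) (ycoord \o p) (zcoord \o p).

Lemma state_window_closed N (s : nat -> R) r (p : state R) :
  (forall i, s i ^+ 2 = 1) -> ~ state_window N s r p ->
  exists2 eta, 0 < eta & forall q, sqdist N p q < eta -> ~ state_window N s r q.
Proof.
move=> s1 /existsNP[i /not_implyP[iN /not_andP npi]].
have sq (u v d : R) : u ^+ 2 + v ^+ 2 < d ^+ 2 -> 0 <= d -> `|u| < d.
  move=> uv d0; rewrite -ltr_sqr ?nnegrE// real_normK ?num_real//.
  by have := sqr_ge0 v; lra.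
have cmp q (d : R) : sqdist N p q < d ^+ 2 -> 0 <= d ->
    [/\ `|xcoord (p i) - xcoord (q i)| < d, `|ycoord (p i) - ycoord (q i)| < d &
        `|zcoord (p i) - zcoord (q i)| < d].
  move=> pq d0; have := le_lt_trans (spin_sqdist_le p q iN) pq.
  rewrite /spin_sqdist; set u := xcoord _ - _; set v := ycoord _ - _; set w := zcoord _ - _.
  have [[u0 v0] w0] := (sqr_ge0 u, sqr_ge0 v, sqr_ge0 w) => h.
  by split; rewrite -ltr_sqr ?nnegrE// real_normK ?num_real//; lra.
have le1 (q : sphere2 R) : [/\ `|xcoord q| <= 1, `|ycoord q| <= 1 & `|zcoord q| <= 1].
  have := sphere2_sqnorm q.
  have [[u0 v0] w0] := (sqr_ge0 (xcoord q), sqr_ge0 (ycoord q), sqr_ge0 (zcoord q)) => h.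
  by split; rewrite -ler_sqr ?nnegrE// expr1n real_normK ?num_real//; lra.
case: npi => /negP; rewrite -ltNge /= => npi.
  (* Each of the two squares changes by less than 2 d, so a quarter of the excess over r^2 is a safe
     distance. *)
  pose d := (xcoord (p i) ^+ 2 + ycoord (p i) ^+ 2 - r ^+ 2) / 4.
  have d0 : 0 < d by rewrite divr_gt0// subr_gt0.
  exists (d ^+ 2) => [|q]; first by rewrite exprn_gt0.
  move=> /cmp/(_ (ltW d0))[dx dy _] /(_ i iN)[+ _] /=.
  apply/negP; rewrite -ltNge /=.
  have [px py _] := le1 (p i); have [qx qy _] := le1 (q i).
  have sub (u v : R) : `|u| <= 1 -> `|v| <= 1 -> `|u - v| < d -> u ^+ 2 - v ^+ 2 < 2 * d.
    move=> u1 v1 uv; rewrite subr_sqr; apply: le_lt_trans (ler_norm _) _.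
    rewrite normrM mulrC; have [->|nz] := eqVneq `|u - v| 0; first by rewrite mulr0 mulr_gt0.
    apply: (@le_lt_trans _ _ (2 * `|u - v|)); last by rewrite ltr_pM2l.
    by rewrite ler_wpM2r//; have := ler_normD u v; lra.
  have := sub _ _ px qx dx; have := sub _ _ py qy dy; rewrite /d; lra.
pose d := 2^-1 - s i * zcoord (p i).
have d0 : 0 < d by rewrite subr_gt0.
exists (d ^+ 2) => [|q]; first by rewrite exprn_gt0.
move=> /cmp/(_ (ltW d0))[_ _ dz] /(_ i iN)[_ /=].
apply/negP; rewrite -ltNge /=.
have sn : `|s i| = 1 by apply/eqP; rewrite -sqrp_eq1// real_normK ?num_real// s1.
have : s i * (zcoord (q i) - zcoord (p i)) < d.
  by apply: le_lt_trans (ler_norm _) _; rewrite normrM sn mul1r distrC.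
rewrite /d; lra.
Qed.

End window_sets.

(** * The residual set and the convergence of its trajectories *)

Section generic_states.
Context {R : realType} (e : nat -> R) (E : R).
Variables (e_inj : injective e) (e_le : forall i, `|e i| <= E).
Implicit Types (X Y : state R) (N : nat).

Local Notation phi := (flow e_le).

Definition window_radius N : R := sval (cid2 (window_separation e_inj N)).

Let window_radius_gt0 N : 0 < window_radius N.
Proof. by rewrite /window_radius; case: cid2. Qed.

(** Past the end of [s] the default bit [false] gives the sign 1. Any bit sequence is thus a
    legitimate code for any N, and the codes form a countable type without a length condition. *)
Definition bit_sign (s : seq bool) (i : nat) : R := (-1) ^+ nth false s i.

Let bit_sign_sqr s i : bit_sign s i ^+ 2 = 1.
Proof. by rewrite /bit_sign sqrr_sign. Qed.

(* The bits of s code an equilibrium, true standing for a south spin; nothing is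
   required at the equilibrium whose first N spins all point south. *)
Definition escaping (k : nat * seq bool * nat) : set (state R) :=
  let: (N, s, n) := k in
  [set X | (exists2 j, (j < N)%N & bit_sign s j = 1) ->
    exists2 t, n%:R <= t &
      ~ state_window N (bit_sign s) (window_radius N) (phi N X t)].

Lemma flow_sqdist_continuous N X t (eta : R) : 0 < eta ->
  exists2 d, 0 < d & forall Y, mdist X Y < d ->
    sqdist N (phi N X t) (phi N Y t) < eta.
Proof.
move=> eta0; pose K := expR (8 * N%:R * `|t|) * (N%:R / weight N ^+ 2) + 1.
have K0 : 0 < K.
  by rewrite ltr_wpDl// mulr_ge0 ?expR_ge0// divr_ge0// exprn_ge0// weight_ge0.
(* A distance below 1 dominates its square, which turns the quadratic estimate into a linear one. *)
exists (Num.min 1 (eta / K)); first by rewrite lt_min ltr01 divr_gt0.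
move=> Y; rewrite lt_min => /andP[d1 dK].
apply: le_lt_trans (flow_sqdist_le e_le X Y t (leqnn N)) _.
have d0 : 0 <= mdist X Y by exact: mdist_ge0.
apply: (@le_lt_trans _ _ (K * mdist X Y)); last by rewrite mulrC -ltr_pdivlMr.
apply: (@le_trans _ _ (K * mdist X Y ^+ 2)); last first.
  by rewrite ler_pM2l// expr2 ler_piMl// ltW.
apply: (@le_trans _ _ (expR (8 * N%:R * `|t|) * (N%:R * (mdist X Y / weight N) ^+ 2))).
  by rewrite ler_pM2l ?expR_gt0// sqdist_le_mdist.
have -> : expR (8 * N%:R * `|t|) * (N%:R * (mdist X Y / weight N) ^+ 2) =
    (K - 1) * mdist X Y ^+ 2.
  by rewrite /K addrK; field; rewrite gt_eqF// weight_gt0.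
by rewrite ler_wpM2r ?sqr_ge0// gerBl.
Qed.

Lemma escaping_open k : open (escaping k).
Proof.
case: k => [[N s] n]; rewrite openE => X HX.
have [north|south] := pselect (exists2 j, (j < N)%N & bit_sign s j = 1); last first.
  by apply: (@filterS _ _ _ setT) => [Y _ /south//|]; exact: filterT.
have [t nt nw] := HX north.
have [eta eta0 Heta] := state_window_closed (bit_sign_sqr s) nw.
have [d d0 Hd] := flow_sqdist_continuous N X t eta0.
apply/nbhs_ballP; exists d => // Y; rewrite ballEmdist /= => XY _.
by exists t => //; apply: Heta; exact: Hd.
Qed.

(** If a ball around X missed the set, every trajectory from it would stay in the window from time n
    on. Moving one north spin of the state at time n and flowing back produces a point of the ball,
    and [window_separation] forbids that both trajectories stay. *)
Lemma escaping_dense k : dense (escaping k).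
Proof.
case: k => [[N s] n] A [X AX] oA; apply: contrapT => AO.
have [eps eps0 epsA] : exists2 eps, 0 < eps & forall Y, mdist X Y < eps -> A Y.
  have /nbhs_ballP[eps /= eps0 H] := open_nbhs_nbhs (conj oA AX).
  by exists eps => // Y XY; apply: H; rewrite ballEmdist.
have stay Y : mdist X Y < eps ->
    (exists2 j, (j < N)%N & bit_sign s j = 1) /\ forall t, n%:R <= t ->
    state_window N (bit_sign s) (window_radius N) (phi N Y t).
  move=> XY; have : ~ escaping (N, s, n) Y.
    by move=> OY; apply: AO; exists Y; split => //; exact: epsA.
  move=> /not_implyP[north H]; split=> // t nt; apply: contrapT => nw.
  by apply: H; exists t.
have [[j jN sj] stayX] : (exists2 j, (j < N)%N & bit_sign s j = 1) /\ forall t, n%:R <= t ->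
    state_window N (bit_sign s) (window_radius N) (phi N X t).
  by apply: stay; rewrite mdistxx.
pose Z := phi N X n%:R.
have XE : phi N Z (- n%:R) = X by rewrite /Z flowD addrC subrr flow0.
(* The backward flow changes all spins through the control, not only spin j. The spins beyond M cost
   less than eps / 2; the first M cost at most eps / 4, the perturbation being divided by the
   expansion factor [K] of the backward flow. *)
have [M NM M2] : exists2 M, (N <= M)%N & 2 * 2 ^- M < eps / 2 :> R.
  have : 2^-1 ^+ k @[k --> \oo] --> (0 : R).
    by apply: cvg_expr; rewrite ger0_norm ?invr_ge0// invf_lt1// ltr1n.
  move=> /cvgrPdist_lt /(_ (eps / 4)) [|m _ Hm]; first by rewrite divr_gt0.
  exists (maxn N m); first exact: leq_maxl.
  have := Hm (maxn N m) (leq_maxr _ _).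
  by rewrite /= sub0r normrN ger0_norm ?exprn_ge0 ?invr_ge0// exprVn; lra.
pose K := expR (8 * M%:R * `|- n%:R|) : R.
have K0 : 0 < K := expR_gt0 _.
have Zj : 2^-1 <= zcoord (Z j).
  by have [_] := stayX n%:R (lexx _) j jN; rewrite sj mul1r.
have eta0 : 0 < (eps / 4) ^+ 2 / K by rewrite divr_gt0// exprn_gt0// divr_gt0.
have [q qd qx] := sphere2_perturb Zj eta0.
pose Z' : state R := fun i => if i == j then q else Z i.
pose Y := phi N Z' (- n%:R).
have ZZ' : sqdist M Z Z' <= (eps / 4) ^+ 2 / K.
  rewrite /sqdist (bigD1 (Ordinal (leq_trans jN NM)))//= big1 ?addr0 /Z' ?eqxx// => i ij.
  rewrite ifN; first by rewrite /spin_sqdist !subrr expr0n/= !addr0.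
  by apply: contra ij => /eqP ij; apply/eqP/val_inj.
have XY : mdist X Y < eps.
  apply: le_lt_trans (mdist_le_sqdist M X Y) _.
  have : sqdist M X Y <= (eps / 4) ^+ 2.
    rewrite -[X in sqdist _ X _]XE.
    apply: le_trans (flow_sqdist_le e_le Z Z' _ NM) _.
    by rewrite -/K mulrC -ler_pdivlMr.
  move=> /ler_wsqrtr; rewrite sqrtr_sqr ger0_norm; last by rewrite divr_ge0// ltW.
  by move: M2 eps0; lra.
have [_ stayY] := stay _ XY.
have YE t : phi N Y (t + n%:R) = phi N Z' t.
  by rewrite /Y flowD addrK.
have ZE t : phi N X (t + n%:R) = phi N Z t by rewrite /Z flowD.
have [] := svalP (cid2 (window_separation e_inj N)).
rewrite -/(window_radius N) => _ sep; apply: qx.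
have [||i iN ij|] := sep (bit_sign s) _ _ _ _ _ _ j (bit_sign_sqr s)
  (flow_curve e_le N Z) (flow_curve e_le N Z') _ _ jN sj.
- by move=> t t0; have := stayX (t + n%:R); rewrite ZE; apply; rewrite lerDr.
- by move=> t t0; have := stayY (t + n%:R); rewrite YE; apply; rewrite lerDr.
- by rewrite !flow0 /Z' (negbTE ij).
- by rewrite !flow0 /Z' eqxx.
Qed.

Definition generic_state : set (state R) := \bigcap_k escaping k.

Lemma generic_state_residual : residual generic_state.
Proof.
(* The triples are enumerated by their codes; a number that codes no triple gets the whole space. *)
exists (fun m => if unpickle m is Some k then escaping k else setT); split.
  move=> m; case: unpickle => [k|]; last first.
    by split; [exact: openT|move=> A A0 _; rewrite setIT].
  by split; [exact: escaping_open|exact: escaping_dense].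
by move=> X HX k _; have := HX (pickle k) I; rewrite pickleK.
Qed.

(** From T on f stays away from 0, so the intermediate value theorem freezes its sign at the one it
    has at T. *)
Let sign_constant (f df : R -> R) (T t : R) :
  (forall s, is_derive s (1 : R) f (df s)) ->
  (forall s, T <= s -> 4^-1 <= f s ^+ 2) -> T <= t ->
  2^-1 <= (-1) ^+ (f T < 0)%R * f t.
Proof.
move=> fdf f4 Tt.
have sz : 0 <= (-1) ^+ (f T < 0)%R * f t.
  rewrite leNgt; apply/negP => opp.
  have fc : {within `[T, t], continuous f}.
    by apply: continuous_subspaceT; exact: derivative_continuous fdf.
  have [|c] := @IVT R f T t 0 Tt fc.
    move: opp; rewrite ge_min le_max.
    by case: (ltP (f T) 0) => fT; rewrite ?expr1 ?expr0 ?mulN1r ?mul1r ?oppr_lt0 => ft;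
      rewrite ?(ltW ft) ?(ltW fT) ?fT ?orbT.
  rewrite in_itv/= => /andP[Tc _] fc0.
  by have := f4 c Tc; rewrite fc0 expr0n/= leNgt invr_gt0 ltr0n.
have h2 : 0 <= (2^-1 : R) by rewrite invr_ge0.
rewrite -ler_sqr ?nnegrE// exprMn sqrr_sign mul1r.
by apply: le_trans (f4 t Tt); rewrite exprVn -natrX.
Qed.

Lemma generic_state_south X N (eta : R) : generic_state X -> 0 < eta ->
  exists T, forall t, T <= t -> sqdist N (phi N X t) (Xminus R) <= eta.
Proof.
move=> gX eta0; have curve := flow_curve e_le N X.
pose r := window_radius N; have r0 : 0 < r := window_radius_gt0 N.
(* The three bounds serve in turn for the window, for z^2 >= 1 / 4, and for the conclusion: in the
   southern hemisphere 1 + z <= x^2 + y^2, so the squared distance 2 (1 + z) to the south pole is at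
   most twice x^2 + y^2. *)
pose del := Num.min (r ^+ 2) (Num.min 2^-1 (eta / 2)).
have del0 : 0 < del by rewrite !lt_min exprn_gt0// invr_gt0 divr_gt0/= ?ltr0n.
have [T HT] := bloch_curve_equatorial_cvg e_inj curve del0.
have dr : del <= r ^+ 2 by rewrite ge_min lexx.
have dh : del <= 2^-1 by rewrite !ge_min lexx !orbT.
have de : del <= eta / 2 by rewrite !ge_min lexx !orbT.
have zT i t : (i < N)%N -> T <= t -> 4^-1 <= zcoord (phi N X t i) ^+ 2.
  move=> iN /HT; have := sqr_le_sqnorm2 (xcoord \o phi N X t) (ycoord \o phi N X t) iN.
  have := sphere2_sqnorm (phi N X t i); rewrite /=; lra.
pose b i := (zcoord (phi N X T i) < 0)%R.
pose s := mkseq b N.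
have sE i : (i < N)%N -> bit_sign s i = (-1) ^+ b i by move=> iN; rewrite /bit_sign nth_mkseq.
have zs i t : (i < N)%N -> T <= t -> 2^-1 <= bit_sign s i * zcoord (phi N X t i).
  move=> iN Tt; rewrite sE//.
  apply: (@sign_constant (fun t => zcoord (phi N X t i))) Tt => [u|u]; last exact: zT.
  by have [_ _ D _] := curve u i; exact: D.
have win t : T <= t -> state_window N (bit_sign s) r (phi N X t).
  move=> Tt i iN; split; last exact: zs.
  apply: le_trans (sqr_le_sqnorm2 _ _ iN) _.
  exact: le_trans (HT _ Tt) dr.
(* A spin pointing north would make [escaping] apply to the observed signs [s]. With n >= T it
   yields a time after T outside the window, against [win]. *)
have south i : (i < N)%N -> b i.
  move=> iN; apply: contrapT => /negP/negbTE bi.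
  have [n Tn] : exists n : nat, T <= n%:R.
    by exists (Num.truncn `|T|).+1; rewrite (le_trans (ler_norm T))// ltW// truncnS_gt.
  have [|t nt] := gX (N, s, n) I; first by exists i; rewrite ?sE ?bi.
  by apply; apply: win; exact: le_trans nt.
exists T => t Tt; apply: (@le_trans _ _ (2 * del)); last by lra.
apply: le_trans (ler_wpM2l (ler0n R 2) (HT _ Tt)).
rewrite /sqdist /sqnorm2 mulr_sumr; apply: ler_sum => i _.
have := zs i t (ltn_ord i) Tt; rewrite sE// south// expr1 mulN1r.
have := sphere2_sqnorm (phi N X t i).
have [sx sy sz] : [/\ xcoord (Xminus R i) = 0, ycoord (Xminus R i) = 0 &
    zcoord (Xminus R i) = -1] by rewrite /xcoord /ycoord /zcoord /= !mxE.
rewrite /spin_sqdist sx sy sz.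
set x := xcoord _; set y := ycoord _; set z := zcoord _ => xyz z2.
have x20 := sqr_ge0 x; have y20 := sqr_ge0 y.
have z1 : - z <= 1 by rewrite -ler_sqr ?nnegrE ?expr1n ?sqrrN//; lra.
have : (- z) * (- z) <= - z by rewrite ler_piMl//; lra.
rewrite !subr0 opprK; lra.
Qed.

(** The control of index N settles the first N spins only. The others contribute at most 2 * 2^-N to
    the distance, so N must be large before the time is. *)
Lemma generic_state_cvg X : generic_state X ->
  cvg_asymptotically_pointwise (fun N => phi N X) (Xminus R).
Proof.
move=> gX eps eps0.
have [m Hm] : exists m, forall N, (m <= N)%N -> 2 * 2 ^- N <= eps / 2 :> R.
  have : 2^-1 ^+ k @[k --> \oo] --> (0 : R).
    by apply: cvg_expr; rewrite ger0_norm ?invr_ge0// invf_lt1// ltr1n.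
  move=> /cvgrPdist_le /(_ (eps / 4)) [|m _ Hm]; first by rewrite divr_gt0.
  exists m => N /Hm.
  by rewrite /= sub0r normrN ger0_norm ?exprn_ge0 ?invr_ge0// exprVn; lra.
exists m.+1 => // N mN.
have eta0 : 0 < (eps / 2) ^+ 2 by rewrite exprn_gt0// divr_gt0.
have [T HT] := generic_state_south N gX eta0.
exists T => t /HT h; apply: le_trans (mdist_le_sqdist N _ _) _.
have := Hm N (ltnW mN); move: h => /ler_wsqrtr.
rewrite sqrtr_sqr ger0_norm; last by rewrite divr_ge0// ltW.
lra.
Qed.

End generic_states.

Theorem theorem3 (R : realType) (e : nat -> R)
    (e_inj : injective e)
    (e_bounded : exists a b : R, forall i : nat, a <= e i <= b) :
  exists G : set (state R), residual G /\
    forall X : state R, G X ->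
      exists u : nat -> state R -> R * R,
        (forall N : nat, (0 < N)%N -> u N = truncated_feedback N) /\
        exists Xi : nat -> R -> state R,
          (forall N : nat, (0 < N)%N ->
             unique (ivp_solution e (u N) X) (Xi N)) /\
          cvg_asymptotically_pointwise Xi (Xminus R).
Proof.
have [E e_le] : exists E, forall i, `|e i| <= E.
  have [a [b ab]] := e_bounded; exists (`|a| + `|b|) => i.
  have /andP[ai ib] := ab i; rewrite ler_norml.
  have := ler_norm b; have := ler_norm (- a); rewrite normrN.
  have := normr_ge0 a; have := normr_ge0 b => ? ? ? ?.
  by apply/andP; split; lra.
exists (generic_state e_inj e_le); split; first exact: generic_state_residual.
move=> X gX; exists truncated_feedback; split=> //.
exists (fun N => flow e_le N X); split; last exact: generic_state_cvg gX.
by move=> N _; split; [exact: flowP|move=> Xi; exact: flow_unique].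
Qed.
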